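(* For every $p\in(1/2,1)$ there exists a finite value $\beta_u=\beta_u(p)>1$ such that for every $\beta>\beta_u(p)$, $$\lim_{n\to\infty}\frac{X_n}{n}=0\qquad \mathbb{P}^{\beta}\text{-a.s.}$$ Further, these values satisfy $\lim_{p\searrow 1/2}\beta_u(p)=1$.
   Context: Percolation: i.i.d. bond percolation with parameter $p\in(p_c,1)$, $p_c=1/2$, on the nearest-neighbour lattice $\mathbb{Z}^2$ (each edge open with probability $p$, closed otherwise, independently). There is a.s. a unique infinite open cluster. Let $\widehat P_p$ be the law of the configuration $\omega$ conditioned on the (positive probability) event that there is an infinite open cluster in the left half-plane $\{(x,y):x\le 0\}$ (using only edges inside this half-plane) and that the origin belongs to it. Walk: for $\beta>1$ and a configuration $\omega$ whose infinite cluster contains the origin, $P_\omega^\beta$ is the law of the Markov chain $Z_n=(X_n,Y_n)$, $Z_0=0$, on the infinite cluster (of the whole plane) with the following transitions. Let $l_n$ be the number of neighbours of $Z_n$ in the infinite cluster (vertices joined to $Z_n$ by an open edge). If $(X_n+1,Y_n)$ is one of these neighbours, then $Z_{n+1}=(X_n+1,Y_n)$ with probability $\beta/(\beta+l_n-1)$ and $Z_{n+1}$ equals each of the other neighbours with probability $1/(\beta+l_n-1)$. If the edge from $Z_n$ to $(X_n+1,Y_n)$ is closed, $Z_{n+1}$ is chosen uniformly among the neighbours of $Z_n$. $\mathbb{P}^\beta$ is the joint law of $(\omega,(Z_n)_{n\ge1})$ when $\omega$ has law $\widehat P_p$ and, given $\omega$, $(Z_n)$ has law $P^\beta_\omega$.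 *)

(* Defs.v *)
From mathcomp Require Import all_boot all_order all_algebra.
From mathcomp Require Import all_classical all_reals all_analysis.
Import Order.TTheory GRing.Theory Num.Theory.
Import numFieldTopology.Exports numFieldNormedType.Exports.
Set Implicit Arguments.
Unset Strict Implicit.
Unset Printing Implicit Defensive.
Local Open Scope classical_set_scope.
Local Open Scope ring_scope.

Definition vertex : Type := (int * int)%type.

Definition e1 : vertex := (1, 0).
Definition e2 : vertex := (0, 1).

(* The pair (x, false) encodes the edge {x, x + e1} and (x, true) the edge
   {x, x + e2}, so every nearest-neighbour edge of Z^2 is encoded once. *)
Definition edge : Type := (vertex * bool)%type.

Definition coordinate_events : set_system (edge -> bool) :=
  [set [set w | w e = true] | e in [set: edge]].

(* Edge configurations (true = open), with the product sigma-algebra. *)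
Definition config := g_sigma_algebraType coordinate_events.

Definition open_adj (w : config) : rel vertex := fun x y =>
  [|| (y == x + e1) && w (x, false), (x == y + e1) && w (y, false),
      (y == x + e2) && w (x, true) | (x == y + e2) && w (y, true)].

Definition neighbours (x : vertex) : seq vertex :=
  [:: x + e1; x - e1; x + e2; x - e2].

Definition open_degree (w : config) (x : vertex) : nat :=
  count (open_adj w x) (neighbours x).

Definition left_half_plane : pred vertex := fun x => x.1 <= 0.

(* The vertices of the left half-plane reachable from x by open edges with
   both endpoints in the left half-plane (for x in that half-plane). *)
Definition left_cluster (w : config) (x : vertex) : set vertex :=
  [set y | exists2 s : seq vertex,
     path [rel u v | [&& left_half_plane u, left_half_plane v
                       & open_adj w u v]] x s
     & last x s = y].

Definition origin_in_infinite_left_cluster : set config :=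
  [set w | infinite_set (left_cluster w 0)].

Section laws.
Context {R : realType}.

Definition percolation_law (p : R) (Q : probability config R) : Prop :=
  forall (s : seq edge) (b : edge -> bool), uniq s ->
    Q [set w | {in s, forall e, w e = b e}] =
    (\prod_(e <- s) (if b e then p else 1 - p))%:E.

(* One-step probabilities of the walk in the environment w.  An open neighbour
   of a vertex of the infinite cluster is again in the infinite cluster, so
   membership in the cluster need not be tested.  All positive values have
   open_degree w x > 0, hence a nonzero denominator when 1 < beta. *)
Definition transition (beta : R) (w : config) (x y : vertex) : R :=
  if ~~ open_adj w x y then 0
  else if open_adj w x (x + e1) then
    (if y == x + e1 then beta else 1) / (beta + (open_degree w x)%:R - 1)
  else 1 / (open_degree w x)%:R.

(* The probability that the quenched chain started at 0 satisfies
   Z_0 = z 0, ..., Z_n = z n. *)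
Definition quenched_prob (beta : R) (w : config) (n : nat) (z : nat -> vertex)
    : R :=
  (z 0%N == 0)%:R * \prod_(k < n) transition beta w (z k) (z k.+1).

(* (om, Z), defined on the probability space (T, P), is distributed as a
   random environment om together with the quenched walk Z in it: the law of
   om is the percolation law conditioned on origin_in_infinite_left_cluster,
   and quenched_prob gives the conditional law of Z given om (these identities
   determine the joint law, since the cylinder events generate the
   sigma-algebra of trajectories). *)
Record annealed_walk (p beta : R) (d : measure_display) (T : measurableType d)
    (P : probability T R) (om : T -> config) (Z : nat -> T -> vertex)
    : Prop := AnnealedWalk {
  annealed_measurable_env : measurable_fun [set: T] om ;
  annealed_measurable_walk :
    forall n x, measurable [set t | Z n t = x] ;
  annealed_env_law :
    exists2 Q : probability config R, percolation_law p Q &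
      forall A : set config, measurable A ->
        P (om @^-1` A) =
        (Q (A `&` origin_in_infinite_left_cluster)
         / Q origin_in_infinite_left_cluster)%E ;
  annealed_walk_law :
    forall (A : set config) (n : nat) (z : nat -> vertex), measurable A ->
      P (om @^-1` A `&` [set t | forall k, (k <= n)%N -> Z k t = z k]) =
      (\int[P]_(t in om @^-1` A) (quenched_prob beta (om t) n z)%:E)%E
}.

End laws.

(* Main.v *)
Require Import Defs.
From mathcomp Require Import all_boot all_order all_algebra.
From mathcomp Require Import all_classical all_reals all_analysis.
From mathcomp Require Import measurable_realfun.
From mathcomp Require Import ring lra zify.
Import Order.TTheory GRing.Theory Num.Theory.
Import numFieldTopology.Exports numFieldNormedType.Exports.
Set Implicit Arguments.
Unset Strict Implicit.
Unset Printing Implicit Defensive.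
Local Open Scope classical_set_scope.
Local Open Scope ring_scope.

(** The walk moves to the right only by crossing fresh columns. When it first
    reaches a column, the edges ahead of it are independent of its past and of
    the conditioning, which concern edges further left (integral_indep). With a
    fixed probability q it faces a trap: a finite open cluster closed on all
    sides except for the edge through which the walk enters, and extending m
    columns to the right (trap). The walk is reversible, with conductances that
    grow like beta^k in column k, so a formula of Kac bounds below the mean time
    lost in the trap by a constant times beta^m (kac, trap_slows). The mean
    discounts of the hitting times of the columns L, 2 L, 3 L, ... then shrink by
    a fixed factor at each step (renewal_bound), and
    the time to reach column L k exceeds j L k for large k if the mean delay
    q beta^m is large compared with j L (upper_tail). If q decays with m at a
    slower exponential rate than beta^-m, this holds for every j and the walk has
    no positive speed. It has no negative speed either: by reversibility it is at
    distance b to the left with probability at most a polynomial times beta^-b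
    (lower_tail).

    The threshold therefore depends on how cheaply long traps can be built, and
    for it to tend to 1 their probability must be e^(-o(m)) near p = 1/2. There, a
    box equal to its own dual has an open crossing with probability at least
    1/2, because either it has one or the dual box has a closed one
    (cross_or_dual, from a discrete Stokes formula) and both have the same
    probability. Fixing the end points costs a polynomial factor; reflecting and
    repeating the connection gives an open tube of fixed width n and any
    length, at a polynomial cost per block of length 2 (n + 1) (tube_crossing).
    The same estimate for closed dual paths gives walls above and below
    (wall), and the edges of the tube and of the walls are disjoint, so the
    probabilities multiply (avg_trap_event). Passing from 1/2 to p costs a
    factor 2 (1 - p) per edge (avg_half_le). All together, a trap with blocks of
    width n works for beta as soon as trap_gain n p beta > 1. The threshold is
    the infimum of such beta, to which p - 1/2 is added. For fixed x > 1 a large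
    n makes x^(2 n + 2) dominate the polynomial cost, and then x is above the
    infimum for p close to 1/2. *)

(** * Averages over finitely many independent edges *)

Definition upd (w : edge -> bool) (e : edge) (b : bool) : edge -> bool :=
  fun e' => if e' == e then b else w e'.

Definition determined (S : Type) (K : pred edge) (F : (edge -> bool) -> S) :=
  forall w w', (forall e, K e -> w e = w' e) -> F w = F w'.

Section average.
Context {R : realType}.
Implicit Types (p : R) (s : seq edge) (K : pred edge) (w : edge -> bool).
Implicit Types F G : (edge -> bool) -> R.

(** Average of F over the states of the edges in the list, each open with
    probability p; the other edges keep the state given by w. Lists and
    functionals turn independence, relabelling and changes of p into plain
    inductions, and no infinite product measure has to be built at p = 1/2. *)
Fixpoint avg p s F w : R :=
  if s is e :: s' then
    p * avg p s' F (upd w e true) + (1 - p) * avg p s' F (upd w e false)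
  else F w.

Lemma eq_avg p s F G : F =1 G -> avg p s F =1 avg p s G.
Proof.
by move=> FG; elim: s => //= e s IH w; rewrite !IH.
Qed.

Lemma avg_cst p s (c : R) w : avg p s (fun=> c) w = c.
Proof. by elim: s w => //= e s IH w; rewrite !IH; ring. Qed.

Lemma avgD p s F G w :
  avg p s (fun w => F w + G w) w = avg p s F w + avg p s G w.
Proof. by elim: s w => //= e s IH w; rewrite !IH; ring. Qed.

Lemma avg_sum (I : Type) (r : seq I) p s (F : I -> (edge -> bool) -> R) w :
  avg p s (fun w => \sum_(i <- r) F i w) w = \sum_(i <- r) avg p s (F i) w.
Proof.
elim: r => [|i r IH].
  rewrite big_nil (eq_avg _ _ (G := fun=> 0)) ?avg_cst// => ?.
  by rewrite big_nil.
rewrite big_cons -IH -avgD; apply: eq_avg => ?; by rewrite big_cons.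
Qed.

Lemma le_avg p s F G w : 0 <= p <= 1 -> (forall w, F w <= G w) ->
  avg p s F w <= avg p s G w.
Proof.
move=> /andP[p0 p1] FG; elim: s w => //= e s IH w.
by apply: lerD; apply: ler_wpM2l => //; rewrite subr_ge0.
Qed.

Lemma avg_ge0 p s F w : 0 <= p <= 1 -> (forall w, 0 <= F w) ->
  0 <= avg p s F w.
Proof. by move=> p01 F0; rewrite -(avg_cst p s 0 w); exact: le_avg. Qed.

Lemma avg_le1 p s F w : 0 <= p <= 1 -> (forall w, F w <= 1) -> avg p s F w <= 1.
Proof. by move=> p01 F1; rewrite -(avg_cst p s 1 w); exact: le_avg. Qed.

Lemma upd_agree K w w' e b : (forall e, K e -> w e = w' e) ->
  forall e', K e' -> upd w e b e' = upd w' e b e'.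
Proof. by move=> ww e' Ke'; rewrite /upd; case: eqP => // _; exact: ww. Qed.

Lemma avg_determined p s K F : determined K F -> determined K (avg p s F).
Proof.
move=> dF; elim: s => [|e s IH] w w' ww /=; first exact: dF.
by congr (_ * _ + _ * _); apply: IH; exact: upd_agree.
Qed.

Lemma determined_upd (S : Type) K (F : (edge -> bool) -> S) w e b :
  determined K F -> ~~ K e -> F (upd w e b) = F w.
Proof.
move=> dF Ke; apply: dF => e' Ke'; rewrite /upd; case: eqP => // ee.
by rewrite -ee Ke' in Ke.
Qed.

(** No edge influences both factors, so the average can be taken edge by edge
    in the factor that the edge influences. *)
Lemma avg_indep p s K K' F G w : determined K F -> determined K' G ->
  (forall e, K e -> ~~ K' e) ->
  avg p s (fun w => F w * G w) w = avg p s F w * avg p s G w.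
Proof.
move=> dF dG KK'; elim: s w => //= e s IH w; rewrite !IH.
have [Ke|Ke] := boolP (K e).
  rewrite !(determined_upd w _ (avg_determined p s dG) (KK' _ Ke)); ring.
rewrite !(determined_upd w _ (avg_determined p s dF) Ke); ring.
Qed.

Lemma upd_comm w e e' b b' : e != e' ->
  upd (upd w e b) e' b' =1 upd (upd w e' b') e b.
Proof.
move=> ee x; rewrite /upd; case: eqP => // -> .
by rewrite eq_sym (negbTE ee).
Qed.

Lemma eq_avg_conf p s F w w' : w =1 w' -> avg p s F w = avg p s F w'.
Proof. by move=> /funext ->. Qed.

Lemma avg_rot p e s F w : e \notin s ->
  avg p (rcons s e) F w = avg p (e :: s) F w.
Proof.
elim: s w => //= e' s IH w; rewrite inE negb_or => /andP[ee es].
rewrite !IH //=.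
rewrite !(eq_avg_conf _ _ _ (upd_comm w _ _ ee)); ring.
Qed.

Lemma avg_cat p s s' F w : avg p (s ++ s') F w = avg p s (avg p s' F) w.
Proof. by elim: s w => //= e s IH w; rewrite !IH. Qed.

Lemma avg_insert p e s s' F w : e \notin s ->
  avg p (s ++ e :: s') F w = avg p (e :: s ++ s') F w.
Proof.
by move=> es; rewrite -cat_rcons avg_cat avg_rot//= !avg_cat.
Qed.

Lemma avg_perm p s s' F w : uniq s -> perm_eq s s' ->
  avg p s F w = avg p s' F w.
Proof.
elim: s s' w => [|e s IH] s' w us pss'.
  by move: pss'; rewrite perm_sym => /perm_nilP ->.
have es' : e \in s' by rewrite -(perm_mem pss') mem_head.
have us' : uniq s' by rewrite -(perm_uniq pss').
case/splitPr: es' pss' us' => s1 s2 pss' us'.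
rewrite avg_insert; last first.
  by move: us'; rewrite cat_uniq /= negb_or => /and3P[_ /andP[]].
have ps : perm_eq s (s1 ++ s2).
  by rewrite -(perm_cons e) (perm_trans pss')// perm_catC /= perm_cons perm_catC.
by move: us => /= /andP[_ us]; rewrite !(IH (s1 ++ s2)).
Qed.

Lemma avg_filter p s K F w : determined K F ->
  avg p [seq e <- s | K e] F w = avg p s F w.
Proof.
move=> dF; elim: s w => //= e s IH w; case: ifPn => Ke /=; rewrite !IH//.
rewrite !(determined_upd w _ (avg_determined p s dF) Ke); ring.
Qed.

Lemma avg_conf p s K F w w' : determined K F ->
  (forall e, K e -> e \in s \/ w e = w' e) -> avg p s F w = avg p s F w'.
Proof.
move=> dF; elim: s w w' => [|e s IH] w w' h /=.
  by apply: dF => e /h[].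
congr (_ * _ + _ * _); apply: IH => e' /h; rewrite inE /upd;
  by case: eqP => [_|_ [/= ->|->]]; [right|left|right].
Qed.

(** An event may be averaged over whichever list is convenient. *)
Lemma avg_eq p s s' K F w w' : determined K F -> uniq s -> uniq s' ->
  (forall e, K e -> e \in s) -> (forall e, K e -> e \in s') ->
  avg p s F w = avg p s' F w'.
Proof.
move=> dF us us' Ks Ks'.
rewrite (avg_conf p (s := s) (w' := w') dF); last by move=> e /Ks; left.
rewrite -(avg_filter _ s _ dF) -(avg_filter _ s' _ dF).
apply: avg_perm; first exact: filter_uniq.
apply: uniq_perm; rewrite ?filter_uniq// => e; rewrite !mem_filter.
by case Ke: (K e) => //=; rewrite Ks ?Ks'.
Qed.

(** Each of the weights p and 1 - p is at least 2 (1 - p) times the fair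
    weight 1/2. Events at p are thus compared with the self-dual point, at a
    cost per edge that tends to 1 as p decreases to 1/2. *)
Lemma avg_half_le p s F w : 1/2 <= p < 1 -> (forall w, 0 <= F w) ->
  (2 * (1 - p)) ^+ size s * avg (1/2) s F w <= avg p s F w.
Proof.
move=> /andP[p1 p2] F0; elim: s w => [|e s IH] w /=; first by rewrite expr0 mul1r.
have h w' : 0 <= avg (1/2) s F w' by apply: avg_ge0 => //; apply/andP; split; lra.
have g w' : 0 <= (2 * (1 - p)) ^+ size s * avg (1/2) s F w'.
  by apply: mulr_ge0 => //; apply: exprn_ge0; lra.
rewrite exprS; set c := (2 * (1 - p)) ^+ _ in IH g *.
have -> : 2 * (1 - p) * c * (1 / 2 * avg (1 / 2) s F (upd w e true) +
   (1 - 1 / 2) * avg (1 / 2) s F (upd w e false)) =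
   (1 - p) * (c * avg (1 / 2) s F (upd w e true)) +
   (1 - p) * (c * avg (1 / 2) s F (upd w e false)) by field.
apply: lerD.
  apply: (@le_trans _ _ (p * (c * avg (1 / 2) s F (upd w e true)))).
    by apply: ler_wpM2r => //; lra.
  by apply: ler_wpM2l => //; lra.
by apply: ler_wpM2l => //; lra.
Qed.

(** Fair averages do not distinguish open from closed: this is where the value
    p = 1/2 matters. *)
Lemma avg_relabel (f : edge -> edge) (b : bool) s F w : injective f ->
  avg (1/2) (map f s) (fun w => F (fun e => b (+) w (f e))) w =
  avg (1/2) s F (fun e => b (+) w (f e)).
Proof.
move=> fI; elim: s w => //= e s IH w; rewrite !IH.
have E c : (fun e' => b (+) upd w (f e) c (f e')) =
           upd (fun e' => b (+) w (f e')) e (b (+) c).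
  apply/funext => e'; rewrite /upd (inj_eq fI); by case: eqP.
by rewrite !E; case: b {E IH} => /=; field.
Qed.

Lemma avg_relabel_id p (f : edge -> edge) s F w : injective f ->
  avg p (map f s) (fun w => F (fun e => w (f e))) w =
  avg p s F (fun e => w (f e)).
Proof.
move=> fI; elim: s w => //= e s IH w; rewrite !IH.
have E c : (fun e' => upd w (f e) c (f e')) = upd (fun e' => w (f e')) e c.
  by apply/funext => e'; rewrite /upd (inj_eq fI); case: eqP.
by rewrite !E.
Qed.

End average.

Implicit Types (w : edge -> bool) (x y : vertex).

Lemma determined_sub (S : Type) (K K' : pred edge) (F : (edge -> bool) -> S) :
  determined K F -> (forall e, K e -> K' e) -> determined K' F.
Proof. by move=> dF h v v' vv; apply: dF => e /h; exact: vv. Qed.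

Lemma determined_comp (S S' : Type) K (F : (edge -> bool) -> S) (g : S -> S') :
  determined K F -> determined K (fun w => g (F w)).
Proof. by move=> dF w w' /dF ->. Qed.

Lemma determined_relabel (S : Type) (K K' : pred edge) (f : edge -> edge)
    (b : bool) (F : (edge -> bool) -> S) :
  determined K F -> (forall e, K e -> K' (f e)) ->
  determined K' (fun w => F (fun e => b (+) w (f e))).
Proof.
by move=> dF h v v' vv; apply: dF => e Ke; rewrite vv //; exact: h.
Qed.

(** The edges that determine F and their images under f may be averaged within
    any larger lists, so the lists of the two sides are unrelated. *)
Lemma avg_relabel_det (R : realType) (f g : edge -> edge) (b : bool)
    (s s' : seq edge) (K : pred edge) (F : (edge -> bool) -> R) w w' :
  cancel f g -> determined K F -> uniq s -> uniq s' ->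
  (forall e, K e -> e \in s) -> (forall e, K e -> f e \in s') ->
  avg (1/2) s' (fun w => F (fun e => b (+) w (f e))) w = avg (1/2) s F w'.
Proof.
move=> fK dF us us' Ks Ks'.
pose K' e := (f (g e) == e) && K (g e).
have dF' : determined K' (fun w => F (fun e => b (+) w (f e))).
  move=> v v' vv; apply: dF => e Ke; congr (_ (+) _); apply: vv.
  by rewrite /K' fK eqxx.
have fI := can_inj fK.
rewrite (avg_eq (1/2) (s' := map f s) _ w dF') //.
- by rewrite avg_relabel //; exact: (avg_eq _ _ _ dF us us Ks Ks).
- by rewrite map_inj_uniq.
- by move=> e /andP[/eqP fe /Ks']; rewrite fe.
- by move=> e /andP[/eqP fe /Ks h]; rewrite -fe map_f.
Qed.

Section cylinders.
Context {R : realType}.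

Lemma avg_out (p : R) s K (F : (edge -> bool) -> R) w : determined K F ->
  (forall e, e \in s -> ~~ K e) -> avg p s F w = F w.
Proof.
move=> dF; elim: s w => //= e s IH w h.
rewrite !IH; try by move=> e' es; apply: h; rewrite inE es orbT.
by rewrite !(determined_upd w _ dF) ?h ?mem_head //; ring.
Qed.

Lemma avg_cylinder (p : R) s t (b : edge -> bool) w : uniq t -> uniq s ->
  {subset t <= s} ->
  avg p s (fun w => (all (fun e => w e == b e) t)%:R) w =
  \prod_(e <- t) (if b e then p else 1 - p).
Proof.
move=> ut us ts.
have dall t' : determined (fun e => e \in t')
    (fun w => (all (fun e => w e == b e) t')%:R : R).
  by move=> v v' vv; congr (_ %:R); congr nat_of_bool; apply: eq_in_all => e /vv ->.
rewrite (avg_eq p (s' := t) w w (dall t)) //.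
elim: t w ut {ts} => [|e t IH] w; first by rewrite big_nil.
rewrite cons_uniq big_cons => /andP[et ut].
rewrite (eq_avg _ _ (G := fun w => (w e == b e)%:R * (all (fun e => w e == b e) t)%:R)); last first.
  by move=> v /=; rewrite -natrM mulnb.
have d1 : determined (pred1 e) (fun w => (w e == b e)%:R : R).
  by move=> v v' vv; rewrite vv ?inE.
have out e' : e' \in t -> ~~ pred1 e e'.
  by move=> e't; apply: contraNN et => /eqP <-.
have ne e' : pred1 e e' -> e' \notin t by move=> /eqP ->.
rewrite /= !(avg_indep _ _ _ d1 (dall t) ne) !(avg_out _ _ d1 out) !IH //.
by rewrite /upd !eqxx; case: (b e) => /=; ring.
Qed.

End cylinders.

(** * Open paths *)

Lemma open_adjP (w : edge -> bool) (x y : vertex) :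
  reflect [\/ y = (x.1 + 1, x.2) /\ w (x, false),
              x = (y.1 + 1, y.2) /\ w (y, false),
              y = (x.1, x.2 + 1) /\ w (x, true) |
              x = (y.1, y.2 + 1) /\ w (y, true)] (open_adj w x y).
Proof.
have E1 (u : vertex) : u + e1 = (u.1 + 1, u.2).
  by case: u => a b; congr (_, _); rewrite /= addr0.
have E2 (u : vertex) : u + e2 = (u.1, u.2 + 1).
  by case: u => a b; congr (_, _); rewrite /= addr0.
rewrite /open_adj !E1 !E2; apply: (iffP or4P).
  by case=> /andP[/eqP h ?]; [apply: Or41|apply: Or42|apply: Or43|apply: Or44].
by case=> -[h ?]; [apply: Or41|apply: Or42|apply: Or43|apply: Or44];
  apply/andP; split => //; apply/eqP.
Qed.

Lemma open_adj_sym w x y : open_adj w x y = open_adj w y x.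
Proof.
by apply/idP/idP => /open_adjP[] h; apply/open_adjP;
  [apply: Or42|apply: Or41|apply: Or44|apply: Or43|apply: Or42|apply: Or41|apply: Or44|apply: Or43].
Qed.

Lemma open_adj_mono w w' x y : (forall e, w e -> w' e) ->
  open_adj w x y -> open_adj w' x y.
Proof.
move=> h /open_adjP H; apply/open_adjP.
by case: H => -[? /h ?]; [apply: Or41|apply: Or42|apply: Or43|apply: Or44].
Qed.

Definition reach (w : edge -> bool) (x y : vertex) :=
  exists2 s : seq vertex, path (open_adj w) x s & last x s = y.

Definition keep (K : pred edge) (w : edge -> bool) : edge -> bool :=
  fun e => K e && w e.

Lemma reach_refl w x : reach w x x.
Proof. by exists [::]. Qed.

Lemma reach1 w x y : open_adj w x y -> reach w x y.
Proof. by move=> xy; exists [:: y] => //=; rewrite xy. Qed.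

Lemma reach_trans w y x z : reach w x y -> reach w y z -> reach w x z.
Proof.
move=> [s ps <-] [t pt <-]; exists (s ++ t); last by rewrite last_cat.
by rewrite cat_path ps.
Qed.

Lemma reach_ind_inv w (Q : vertex -> Prop) x y :
  (forall u v, Q u -> open_adj w u v -> Q v) -> Q x -> reach w x y -> Q y.
Proof.
move=> h + [s + <-]; elim: s x => //= z s IH x Qx /andP[xz ps].
exact: IH (h _ _ Qx xz) ps.
Qed.

Lemma reach_map (f : vertex -> vertex) w w' x y :
  (forall u v, open_adj w u v -> open_adj w' (f u) (f v)) ->
  reach w x y -> reach w' (f x) (f y).
Proof.
move=> h; apply: (reach_ind_inv (Q := fun y => reach w' (f x) (f y))).
  by move=> u v xu /h uv; exact: reach_trans xu (reach1 uv).
exact: reach_refl.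
Qed.

Lemma reach_sym w x y : reach w x y -> reach w y x.
Proof.
apply: (reach_ind_inv (Q := fun y => reach w y x)); last exact: reach_refl.
by move=> u v xu uv; apply: reach_trans xu; apply: reach1; rewrite open_adj_sym.
Qed.

Lemma reach_mono w w' x y : (forall e, w e -> w' e) ->
  reach w x y -> reach w' x y.
Proof.
by move=> h; apply: (reach_map (f := id)) => u v; exact: open_adj_mono.
Qed.

Definition translate (v : vertex) (e : edge) : edge := (e.1 + v, e.2).

Lemma translateK v : cancel (translate v) (translate (- v)).
Proof. by case=> e t; rewrite /translate /= addrK. Qed.

Lemma open_adj_translate w v x y :
  open_adj (fun e => w (translate v e)) x y = open_adj w (x + v) (y + v).
Proof.
rewrite /open_adj /translate /= ![_ + v + _]addrAC.
by rewrite !(inj_eq (addIr v)).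
Qed.

(** * Crossings of the self-dual box *)

Lemma abel_sum (n : nat) (f g : nat -> int) :
  \sum_(j < n.+1) f j * (g j.+1 - g j) =
  f n * g n.+1 - f 0%N * g 0%N - \sum_(j < n) (f j.+1 - f j) * g j.+1.
Proof.
elim: n => [|n IH]; first by rewrite big_ord_recr !big_ord0 /=; ring.
by rewrite big_ord_recr /= IH [in RHS]big_ord_recr /=; ring.
Qed.

(** Discrete Stokes formula. C i j tells whether the vertex (i, j) is joined
    to the left side, S i j whether the face in column i just below row j is
    joined to the bottom. If both fail to reach the opposite side, then across
    every edge either C or S is constant, so the sum of the products of their
    differences vanishes; summation by parts turns that sum into a boundary
    term equal to 1. *)
Lemma crossing_dichotomy (n : nat) (C S : nat -> nat -> bool) :
  (forall j, (j <= n)%N -> C 0%N j) ->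
  (forall j, (j <= n)%N -> ~~ C n.+1 j) ->
  (forall i, (i <= n)%N -> S i 0%N) ->
  (forall i, (i <= n)%N -> ~~ S i n.+1) ->
  (forall i j, (i <= n)%N -> (j <= n)%N ->
    C i.+1 j != C i j -> S i j.+1 = S i j) ->
  (forall i j, (i < n)%N -> (j < n)%N ->
    C i.+1 j.+1 != C i.+1 j -> S i.+1 j.+1 = S i j.+1) -> False.
Proof.
move=> C0 Cn S0 Sn hh hv.
pose c i j : int := (C i j)%:R; pose s i j : int := (S i j)%:R.
pose T1 := \sum_(i < n.+1) \sum_(j < n.+1)
  (c i.+1 j - c i j) * (s i j.+1 - s i j).
pose T2 := \sum_(j < n) \sum_(i < n)
  (s i.+1 j.+1 - s i j.+1) * (c i.+1 j.+1 - c i.+1 j).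
have T10 : T1 = 0.
  apply: big1 => i _; apply: big1 => j _.
  have [E|/hh] := eqVneq (C i.+1 j) (C i j).
    by rewrite /c E subrr mul0r.
  by move=> /(_ (ltn_ord i) (ltn_ord j)) E; rewrite /s E subrr mulr0.
have T20 : T2 = 0.
  apply: big1 => j _; apply: big1 => i _.
  have [E|/hv] := eqVneq (C i.+1 j.+1) (C i.+1 j).
    by rewrite /c E subrr mulr0.
  by move=> /(_ (ltn_ord i) (ltn_ord j)) E; rewrite /s E subrr mul0r.
suff : T1 = 1 + T2 by rewrite T10 T20.
have -> : T1 = \sum_(i < n.+1) (- (c i.+1 0%N - c i 0%N) -
   \sum_(j < n) s i j.+1 *
     ((c i.+1 j.+1 - c i.+1 j) - (c i j.+1 - c i j))).
  apply: eq_bigr => i _.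
  have /= -> := abel_sum n (fun j => c i.+1 j - c i j) (s i).
  have -> : s i n.+1 = 0 by rewrite /s (negbTE (Sn _ _)) // -ltnS.
  have -> : s i 0%N = 1 by rewrite /s S0 // -ltnS.
  rewrite mulr0 mulr1 sub0r; congr (_ - _).
  by apply: eq_bigr => j _; ring.
have tel : \sum_(i < n.+1) (c i.+1 0%N - c i 0%N) = c n.+1 0%N - c 0%N 0%N.
  by rewrite -(big_mkord xpredT (fun i => c i.+1 0%N - c i 0%N)) telescope_sumr.
rewrite big_split /= !sumrN tel exchange_big /=.
have -> : c 0%N 0%N = 1 by rewrite /c C0.
have -> : c n.+1 0%N = 0 by rewrite /c (negbTE (Cn _ _)).
rewrite sub0r opprK; congr (_ + _); rewrite -sumrN; apply: eq_bigr => j _.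
have /= -> := abel_sum n (fun i => s i j.+1) (fun i => c i j.+1 - c i j).
have jn := ltn_ord j.
have -> : c n.+1 j.+1 - c n.+1 j = 0.
  by rewrite /c !(negbTE (Cn _ _)) ?subrr // ltnW.
have -> : c 0%N j.+1 - c 0%N j = 0.
  by rewrite /c !C0 ?subrr // ltnW.
by rewrite !mulr0 subrr sub0r opprK.
Qed.

Definition rect (x0 y0 : int) (m n : nat) : seq edge :=
  [seq (v, t) | v <- [seq (x0 + i%:Z, y0 + j%:Z) | i <- iota 0 m, j <- iota 0 n],
                t <- [:: false; true]].

Lemma mem_rect (x0 y0 : int) (m n : nat) (x y : int) t :
  (((x, y), t) \in rect x0 y0 m n) =
  (x0 <= x < x0 + m%:Z) && (y0 <= y < y0 + n%:Z).
Proof.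
apply/idP/idP.
  move=> /allpairsP[[v u] /= [/allpairsP[[i j] /= [ii jj ->]] _ [-> -> _]]].
  by move: ii jj; rewrite !mem_iota; lia.
move=> h; apply/allpairsP; exists ((x, y), t) => /=; split => //; last first.
  by case: t.
apply/allpairsP; exists (`|x - x0|%N, `|y - y0|%N) => /=; rewrite !mem_iota.
by split; [lia|lia|congr (_, _); lia].
Qed.

Lemma uniq_rect (x0 y0 : int) (m n : nat) : uniq (rect x0 y0 m n).
Proof.
apply: allpairs_uniq => //; last by move=> [? ?] [? ?] _ _ [-> ->].
apply: allpairs_uniq; rewrite ?iota_uniq //.
by move=> [i j] [i' j'] _ _ /= [? ?]; congr (_, _); lia.
Qed.

Lemma size_rect (x0 y0 : int) (m n : nat) : size (rect x0 y0 m n) = (m * n * 2)%N.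
Proof. by rewrite !size_allpairs !size_iota. Qed.

(** The vertical edges of the two end columns are left out: slabs placed end
    to end have disjoint edges, and a slab of length b + 1 is isomorphic to
    its dual. *)
Definition slab (b l : nat) : pred edge := fun e =>
  let: ((x, y), t) := e in
  if t then (0 < x < l%:Z) && (0 <= y < b%:Z)
  else (0 <= x < l%:Z) && (0 <= y <= b%:Z).

Definition conn (b l i j : nat) (w : edge -> bool) : bool :=
  `[< reach (keep (slab b l) w) (0, i%:Z) (l%:Z, j%:Z) >].

Lemma determined_keep (S : Type) K (F : (edge -> bool) -> S) :
  determined K (fun w => F (keep K w)).
Proof.
move=> w w' ww; congr F; apply/funext => e; rewrite /keep.
by case Ke: (K e) => //=; exact: ww.
Qed.

Lemma determined_conn b l i j : determined (slab b l) (conn b l i j).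
Proof.
exact: (@determined_keep _ _ (fun w => `[< reach w (0, i%:Z) (l%:Z, j%:Z) >])).
Qed.

Section crossing_probability.
Context {R : realType}.

Definition pconn (b l i j : nat) : R :=
  avg (1/2) (rect 0 0 l.+1 b.+1) (fun w => (conn b l i j w)%:R) (fun=> false).

Let dconn b l i j : determined (slab b l) (fun w => (conn b l i j w)%:R : R).
Proof. exact: (determined_comp (fun c : bool => c%:R : R) (@determined_conn b l i j)). Qed.

Lemma slab_rect b l e : slab b l e -> e \in rect 0 0 l.+1 b.+1.
Proof. by case: e => -[x y] [] /=; rewrite mem_rect; lia. Qed.

Lemma pconnE b l i j s w : uniq s -> (forall e, slab b l e -> e \in s) ->
  avg (1/2) s (fun w => (conn b l i j w)%:R) w = pconn b l i j.
Proof.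
move=> us h; apply: avg_eq (@dconn b l i j) us (uniq_rect _ _ _ _) h _.
exact: slab_rect.
Qed.

Lemma pconn_relabel f g (c : bool) b l i j s w : cancel f g -> uniq s ->
  (forall e, slab b l e -> f e \in s) ->
  avg (1/2) s (fun w => (conn b l i j (fun e => c (+) w (f e)))%:R) w =
  pconn b l i j.
Proof.
move=> fK us h.
exact: (avg_relabel_det c w (fun=> false) fK (@dconn b l i j)
  (uniq_rect _ _ _ _) us (@slab_rect b l) h).
Qed.

(** The edge whose dual is the mirror image of e in the diagonal of the box. *)
Definition flip (e : edge) : edge :=
  let: ((x, y), t) := e in
  if t then ((y + 1, x - 1), true) else ((y, x), false).

Lemma flipK : involutive flip.
Proof. by case=> -[x y] [] //=; rewrite subrK addrK. Qed.

Lemma reach_or (W : edge -> bool) (P : vertex -> Prop) u v :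
  open_adj W u v ->
  `[< exists2 x, P x & reach W x u >] = `[< exists2 x, P x & reach W x v >].
Proof.
move=> uv; apply/asbool_equiv_eq; split=> -[x Px xu]; exists x => //.
  exact: reach_trans xu (reach1 uv).
by apply: reach_trans xu (reach1 _); rewrite open_adj_sym.
Qed.

(** A dual crossing from bottom to top becomes, after reflection in the
    diagonal, a crossing from left to right of the configuration whose edge e
    is open when flip e is closed. *)
Lemma cross_or_dual n w :
  (exists i j, [/\ (i <= n)%N, (j <= n)%N & conn n n.+1 i j w]) \/
  (exists i j, [/\ (i <= n)%N, (j <= n)%N &
     conn n n.+1 i j (fun e => true (+) w (flip e))]).
Proof.
apply: contrapT => /not_orP[nC nS].
pose W := keep (slab n n.+1) w.
pose W' := keep (slab n n.+1) (fun e => true (+) w (flip e)).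
pose P (v : vertex) := exists2 i, (i <= n)%N & v = (0, i%:Z) :> vertex.
apply: (@crossing_dichotomy n
  (fun i j => `[< exists2 x, P x & reach W x (i%:Z, j%:Z) >])
  (fun i j => `[< exists2 x, P x & reach W' x (j%:Z, i%:Z) >])).
- move=> j jn; apply/asboolP; exists (0, j%:Z); first by exists j.
  exact: reach_refl.
- move=> j jn; apply/negP => /asboolP[_ [i ? ->] h]; apply: nC.
  by exists i, j; split => //; apply/asboolP.
- move=> j jn; apply/asboolP; exists (0, j%:Z); first by exists j.
  exact: reach_refl.
- move=> j jn; apply/negP => /asboolP[_ [i ? ->] h]; apply: nS.
  by exists i, j; split => //; apply/asboolP.
- move=> i j ni nj; apply: contraNeq; rewrite eq_sym => h.
  rewrite eq_sym; apply/eqP; apply: reach_or; apply/open_adjP; apply: Or41.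
  split; first by congr (_, _) => /=; lia.
  apply: contraR h; rewrite /W /W' /keep /= => h.
  apply/eqP; apply: reach_or; apply/open_adjP; apply: Or41.
  split; first by congr (_, _) => /=; lia.
  by move: h; rewrite /keep /= ; case: (w _); lia.
- move=> i j ni nj; apply: contraNeq; rewrite eq_sym => h.
  rewrite eq_sym; apply/eqP; apply: reach_or; apply/open_adjP; apply: Or43.
  split; first by congr (_, _) => /=; lia.
  apply: contraR h; rewrite /W /W' /keep /= => h.
  apply/eqP; apply: reach_or; apply/open_adjP; apply: Or43.
  split; first by congr (_, _) => /=; lia.
  move: h; rewrite /keep /=.
  have -> : (i%:Z + 1, j.+1%:Z - 1) = (i.+1%:Z, j%:Z) by congr (_, _); lia.
  by case: (w _); lia.
Qed.

(** At p = 1/2 a configuration and its reflected dual have the same law and at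
    least one of them is crossed; the end points are then separated by the
    union bound. *)
Lemma sum_pconn_ge n :
  1/2 <= \sum_(i < n.+1) \sum_(j < n.+1) pconn n n.+1 i j.
Proof.
pose s := rect (- n.+2%:Z) (- n.+2%:Z) (3 * n.+2)%N (3 * n.+2)%N.
pose w0 : edge -> bool := fun=> false.
pose X w : R := \sum_(i < n.+1) \sum_(j < n.+1) (conn n n.+1 i j w)%:R.
have X0 w : 0 <= X w by do 2!apply: sumr_ge0 => ? _; rewrite ler0n.
have X1 w i j : (i <= n)%N -> (j <= n)%N -> conn n n.+1 i j w -> 1 <= X w.
  move=> ni nj h; rewrite /X (bigD1 (Ordinal (ni : (i < n.+1)%N))) //=.
  rewrite (bigD1 (Ordinal (nj : (j < n.+1)%N))) //= h -addrA lerDl.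
  by apply: addr_ge0; do ?[apply: sumr_ge0 => ? _]; rewrite ?ler0n.
have sm e : slab n n.+1 e -> (e \in s) /\ (flip e \in s).
  by case: e => -[x y] [] /=; rewrite !mem_rect => ?; split; lia.
have us : uniq s by exact: uniq_rect.
suff : 1 <= (\sum_(i < n.+1) \sum_(j < n.+1) pconn n n.+1 i j) +
            (\sum_(i < n.+1) \sum_(j < n.+1) pconn n n.+1 i j).
  by move=> h; lra.
have A1 : avg (1/2) s X w0 = \sum_(i < n.+1) \sum_(j < n.+1) pconn n n.+1 i j.
  rewrite avg_sum; apply: eq_bigr => i _; rewrite avg_sum; apply: eq_bigr => j _.
  by rewrite pconnE // => e /sm[].
have A2 : avg (1/2) s (fun w => X (fun e => true (+) w (flip e))) w0 =
    \sum_(i < n.+1) \sum_(j < n.+1) pconn n n.+1 i j.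
  rewrite avg_sum; apply: eq_bigr => i _; rewrite avg_sum; apply: eq_bigr => j _.
  by rewrite (pconn_relabel true _ _ _ flipK) // => e /sm[].
rewrite -{1}A1 -A2 -avgD -[leLHS](avg_cst (1/2) s 1 w0).
apply: le_avg; first by apply/andP; split; lra.
move=> w; have [[i [j [ni nj h]]]|[i [j [ni nj h]]]] := cross_or_dual n w.
  by rewrite -[leLHS]addr0 lerD // (X1 _ _ _ ni nj h).
by rewrite -[leLHS]add0r lerD // (X1 _ _ _ ni nj h).
Qed.

End crossing_probability.

(** * Long tubes at the self-dual point *)

Section long_connections.
Context {R : realType}.
Local Notation pconn := (@pconn R).

Lemma exists_pconn_ge n : exists i j, [/\ (i <= n)%N, (j <= n)%N &
  1 / (2 * n.+1%:R ^+ 2) <= pconn n n.+1 i j].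
Proof.
apply: contrapT => h; have := @sum_pconn_ge R n; apply/negP; rewrite -ltNge.
have N0 : 0 < n.+1%:R :> R by rewrite ltr0n.
have -> : 1 / 2 = \sum_(i < n.+1) \sum_(j < n.+1) 1 / (2 * n.+1%:R ^+ 2) :> R.
  have E (c : R) : \sum_(i < n.+1) c = n.+1%:R * c.
    by rewrite sumr_const card_ord mulr_natl.
  rewrite !E {E}.
  move: (n.+1%:R) N0 => c c0; field; exact: lt0r_neq0.
have lt i j : (i < n.+1)%N -> (j < n.+1)%N ->
    pconn n n.+1 i j < 1 / (2 * n.+1%:R ^+ 2).
  move=> ni nj; rewrite ltNge; apply/negP => le.
  by apply: h; exists i, j.
apply: ltr_sum; first by apply/hasP; exists ord0; rewrite ?mem_index_enum.
move=> i _; apply: ltr_sum => [|j _]; last exact: lt.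
by apply/hasP; exists ord0; rewrite ?mem_index_enum.
Qed.

(** Reflection of the slab in its vertical axis. *)
Lemma pconn_sym b l i j : pconn b l i j = pconn b l j i.
Proof.
pose f (e : edge) : edge := let: ((x, y), t) := e in
  if t then ((l%:Z - x, y), true) else ((l%:Z - 1 - x, y), false).
have fK : involutive f by move=> [[x y] []] /=; congr (_, _, _); ring.
have fs e : slab b l e -> slab b l (f e) by case: e => -[x y] [] /=; lia.
have cf w : conn b l i j (fun e => false (+) w (f e)) = conn b l j i w.
  have aux (w' : edge -> bool) : forall u v,
      open_adj (keep (slab b l) (fun e => w' (f e))) u v ->
      open_adj (keep (slab b l) w') (l%:Z - u.1, u.2) (l%:Z - v.1, v.2).
    move=> [u1 u2] [v1 v2] /open_adjP H; apply/open_adjP; rewrite /keep /=.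
    case: H => -[[-> ->]] /= /andP[/= k wf];
      [apply: Or42|apply: Or41|apply: Or43|apply: Or44];
      (split; first by congr (_, _); ring);
      do ?[have -> : l%:Z - (u1 + 1) = l%:Z - 1 - u1 by ring];
      do ?[have -> : l%:Z - (v1 + 1) = l%:Z - 1 - v1 by ring];
      rewrite wf andbT; lia.
  apply/asboolP/asboolP => h.
    have {h}:= reach_map (aux w) h; rewrite /= subr0 subrr; exact: reach_sym.
  have {h}:= reach_sym h.
  have E : w = (fun e => w (f (f e))) by apply/funext => e; rewrite fK.
  rewrite {1}E => /(reach_map (aux (fun e => w (f e)))).
  by rewrite /= subr0 subrr.
rewrite -(pconn_relabel false i j (fun=> false) fK (uniq_rect 0 0 l.+1 b.+1)).
  by rewrite /pconn; apply: eq_avg => w; rewrite cf.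
by move=> e /fs; exact: slab_rect.
Qed.

Lemma conn_cat b l l' i j k w : conn b l i j w ->
  conn b l' j k (fun e => w (translate (l%:Z, 0) e)) -> conn b (l + l') i k w.
Proof.
move=> /asboolP h /asboolP h'; apply/asboolP.
apply: (@reach_trans _ (l%:Z, j%:Z)).
  apply: reach_mono h => -[[x y] t]; rewrite /keep /= => /andP[k1 ->].
  by case: t k1 => /=; rewrite andbT; lia.
have -> : (l%:Z, j%:Z) = (0, j%:Z) + (l%:Z, 0) :> vertex.
  by congr (_, _) => /=; rewrite ?add0r ?addr0.
have -> : ((l + l')%N%:Z, k%:Z) = (l'%:Z, k%:Z) + (l%:Z, 0) :> vertex.
  by congr (_, _) => /=; lia.
apply: (reach_map (f := fun x => x + (l%:Z, 0))) h' => u v.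
rewrite -open_adj_translate; apply: open_adj_mono => -[[x y] t].
rewrite /keep /translate /= => /andP[k1 ->].
by case: t k1 => /=; rewrite andbT; lia.
Qed.

(** Consecutive slabs have disjoint edges, so independence is enough to join
    the two connections. *)
Lemma pconn_cat b l l' i j k :
  pconn b l i j * pconn b l' j k <= pconn b (l + l') i k.
Proof.
pose s := rect 0 0 (l + l').+1 b.+1; pose w0 : edge -> bool := fun=> false.
have us : uniq s by exact: uniq_rect.
have s1 e : slab b l e -> e \in s.
  by case: e => -[x y] [] /=; rewrite mem_rect; lia.
have s2 e : slab b l' e -> translate (l%:Z, 0) e \in s.
  by case: e => -[x y] [] /=; rewrite /translate mem_rect /=; lia.
rewrite -(pconnE i j w0 us s1).
rewrite -(pconn_relabel false j k w0 (@translateK (l%:Z, 0)) us s2).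
rewrite -(@avg_indep _ _ _ (slab b l) (fun e => slab b l' (translate (- (l%:Z, 0)) e))).
- rewrite /pconn -/s -/w0; apply: le_avg; first by apply/andP; split; lra.
  move=> w; rewrite -natrM ler_nat mulnb; case E: (_ && _) => //; case/andP: E => h1 h2.
  by rewrite (conn_cat h1 h2).
- exact: (determined_comp (fun c : bool => c%:R : R) (@determined_conn b l i j)).
- apply: (determined_comp (fun c : bool => c%:R : R)); apply: (determined_relabel false (@determined_conn b l' j k)).
  by move=> e; rewrite translateK.
- by case=> -[x y] [] /=; lia.
Qed.

Lemma pconn_iter b l i (a : R) M : 0 <= a -> a <= pconn b l i i ->
  a ^+ M <= pconn b (l * M) i i.
Proof.
move=> a0 ha; elim: M => [|M IH].
  rewrite muln0 /pconn (eq_avg _ _ (G := fun=> 1)) ?avg_cst ?expr0 // => w.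
  by rewrite (_ : conn _ _ _ _ _ = true) //; apply/asboolP; exact: reach_refl.
rewrite exprS mulnS; apply: le_trans (@pconn_cat _ _ _ _ i _).
by apply: ler_pM => //; exact: exprn_ge0.
Qed.

(** A connection from height i to height j followed by its mirror image
    returns to height i and can be repeated. One block thus costs a factor
    polynomial in its width, however many blocks there are. *)
Lemma tube_crossing n : exists2 j, (j <= n)%N & forall M,
  ((1 / (2 * n.+1%:R ^+ 2)) ^+ 2) ^+ M <= pconn n (n.+1.*2 * M) j j.
Proof.
have [i [j [ni nj h]]] := exists_pconn_ge n.
have a0 : 0 <= 1 / (2 * n.+1%:R ^+ 2) :> R.
  by apply: divr_ge0 => //; rewrite mulr_ge0 // exprn_ge0.
exists i => // M; apply: pconn_iter; first exact: exprn_ge0.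
rewrite -addnn; apply: le_trans (@pconn_cat _ _ _ _ j _).
by rewrite expr2 (pconn_sym _ _ j); apply: ler_pM.
Qed.

End long_connections.

(** * Dual paths are walls *)

(** The edge of the lattice crossed by a dual edge, the label (x, y) of a dual
    vertex standing for the face with lower left corner (x, y + r). *)
Definition dual (r : int) (e : edge) : edge :=
  let: ((x, y), t) := e in
  if t then ((x, y + r + 1), false) else ((x + 1, y + r), true).

Definition undual (r : int) (e : edge) : edge :=
  let: ((x, y), t) := e in
  if t then ((x - 1, y - r), false) else ((x, y - r - 1), true).

Lemma dualK r : cancel (dual r) (undual r).
Proof. by case=> -[x y] [] /=; congr (_, _, _); ring. Qed.

Fixpoint parity (k : vertex -> vertex -> bool) (f : vertex) (s : seq vertex) :=
  if s is g :: s' then k f g (+) parity k g s' else false.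

Lemma eq_parity (adj : rel vertex) k k' f s : path adj f s ->
  (forall f g, adj f g -> k f g = k' f g) -> parity k f s = parity k' f s.
Proof.
move=> + h; elim: s f => //= g s IH f /andP[fg ps].
by rewrite (h _ _ fg) IH.
Qed.

Lemma parity_xor k k' f s :
  parity (fun f g => k f g (+) k' f g) f s = parity k f s (+) parity k' f s.
Proof. by elim: s f => //= g s IH f; rewrite IH addbACA. Qed.

Lemma parity_telescope (I : pred vertex) f s :
  parity (fun f g => I f (+) I g) f s = I f (+) I (last f s).
Proof.
elim: s f => /= [f|g s IH f]; first by rewrite addbb.
by rewrite IH addbA -(addbA (I f)) addbb addbF.
Qed.

(** The parity of the number of horizontal steps of the dual path above x
    tells on which side of the path x lies. Between neighbours it changes only
    across an edge crossed by the path, and such an edge is closed. *)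
Lemma wall (b l i j : nat) (r : int) (w : edge -> bool) :
  conn b l i j (fun e => true (+) w (dual r e)) ->
  exists h : pred vertex,
  [/\ forall x, 0 < x.1 <= l%:Z -> x.2 <= r -> h x,
      forall x, 0 < x.1 <= l%:Z -> r + b%:Z < x.2 -> ~~ h x &
      forall x y, open_adj w x y -> 0 < x.1 <= l%:Z -> 0 < y.1 <= l%:Z ->
        h x = h y].
Proof.
move=> /asboolP[s ps ls].
pose k (x f g : vertex) := [&& f.2 == g.2, x.2 <= f.2 + r &
  (f.1 == x.1 - 1) && (g.1 == x.1) || (f.1 == x.1) && (g.1 == x.1 - 1)].
pose h x := parity (k x) (0, i%:Z) s.
have hv x : w (x, true) -> h x = h (x.1, x.2 + 1).
  case: x => x1 x2 wx; apply: eq_parity ps _ => -[f1 f2] [g1 g2] /open_adjP.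
  rewrite /keep /k /=.
  case=> -[[? ?]] /andP[/= K N]; subst; try lia.
    have : (f1 + 1, f2 + r) <> (x1, x2) by move=> E; rewrite E wx in N.
    move=> /eqP; rewrite xpair_eqE; lia.
  have : (g1 + 1, g2 + r) <> (x1, x2) by move=> E; rewrite E wx in N.
  move=> /eqP; rewrite xpair_eqE; lia.
have hh x : w (x, false) -> 0 < x.1 < l%:Z -> h x = h (x.1 + 1, x.2).
  case: x => x1 x2 wx /= xl; pose I (f : vertex) := (f.1 == x1) && (x2 <= f.2 + r).
  suff : h (x1, x2) (+) h (x1 + 1, x2) = I (0, i%:Z) (+) I (last (0, i%:Z) s).
    by rewrite ls /I /=; case: (h (x1, x2)) (h (x1 + 1, x2)) => [] [] //=; lia.
  rewrite -parity_telescope /h -parity_xor.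
  apply: eq_parity ps _ => -[f1 f2] [g1 g2] /open_adjP.
  rewrite /keep /k /I /=.
  case=> -[[? ?]] /andP[/= K N]; subst; try lia.
    have : (f1, f2 + r + 1) <> (x1, x2) by move=> E; rewrite E wx in N.
    move=> /eqP; rewrite xpair_eqE; lia.
  have : (g1, g2 + r + 1) <> (x1, x2) by move=> E; rewrite E wx in N.
  move=> /eqP; rewrite xpair_eqE; lia.
exists h; split.
- move=> [x1 x2] /= xl xr; pose J (f : vertex) := f.1 < x1.
  have -> : h (x1, x2) = J (0, i%:Z) (+) J (last (0, i%:Z) s).
    rewrite -parity_telescope; apply: eq_parity ps _ => -[f1 f2] [g1 g2] /open_adjP.
    rewrite /keep /k /J /=; case=> -[[? ?]] /andP[/= K N]; subst; lia.
  rewrite ls /J /=; lia.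
- move=> [x1 x2] /= xl xr.
  have -> : h (x1, x2) = parity (fun _ _ => false) (0, i%:Z) s.
    apply: eq_parity ps _ => -[f1 f2] [g1 g2] /open_adjP.
    rewrite /keep /k /=; case=> -[[? ?]] /andP[/= K N]; subst; lia.
  by elim: s (0, i%:Z) {ps ls h hv hh} => //= ? ? IH ?; rewrite IH.
- move=> x y /open_adjP[] [-> wx] /= xl yl.
  + by apply: hh => //; lia.
  + by apply/esym/hh => //; lia.
  + exact: hv.
  + exact/esym/hv.
Qed.

(** * Traps *)

(** Edges with both end points to the right of column 0. *)
Definition inner : pred edge := fun e => 1 <= e.1.1.

(** A dead end for the walk that enters it from the origin: the open cluster D
    to the right of column 0 meets the rest of the lattice through the edge
    from (0, 0) to (1, 0) only, and it extends to column m. *)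
Record trap (w : edge -> bool) (D : seq vertex) (m L : int) (B : nat) : Prop := Trap {
  trap_uniq : uniq D;
  trap_size : (size D <= B)%N;
  trap_entrance : ((1, 0) : vertex) \in D;
  trap_open : w ((0, 0), false);
  trap_columns : forall x, x \in D -> 0 < x.1 < L;
  trap_closed : forall x y, x \in D -> open_adj w x y ->
    y \in D \/ (x = (1, 0) :> vertex /\ y = (0, 0) :> vertex);
  trap_deep : exists2 z, z \in D & m <= z.1;
  trap_connected : forall x, x \in D -> reach (keep inner w) (1, 0) x }.

Section tube_trap.
Variables (n j M : nat).
Let N2 := n.+1.*2.
Let l' := (N2 * M)%N.
Let l := (N2 * M.+1)%N.
Let H := n.+1.*2.

(** The horizontal edges that close both ends of the trap, up to the height H
    that the walls do not exceed. *)
Definition caps : seq edge :=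
  [seq ((a, k%:Z - H%:Z), false) : edge | a <- [:: 0 : int; l%:Z],
     k <- iota 0 H.*2.+1].

Lemma mem_caps (a c : int) t : (((a, c), t) \in caps) =
  [&& ~~ t, (a == 0) || (a == l%:Z) & - H%:Z <= c <= H%:Z].
Proof.
apply/idP/idP.
  move=> /allpairsP[[a' k] [ha]]; rewrite mem_iota => hk [-> -> ->].
  by move: ha hk; rewrite !inE /= => ->; lia.
case: t => //= /andP[ha hc]; apply/allpairsP; exists (a, absz (c + H%:Z)).
rewrite mem_iota !inE; split=> //=; first lia.
by congr (_, _, _); lia.
Qed.

Lemma uniq_caps : uniq caps.
Proof.
apply: allpairs_uniq; [|exact: iota_uniq|].
  have hl : (0 : int) != l%:Z by rewrite /l /N2; lia.
  by rewrite !cons_uniq in_cons in_nil orbF hl.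
by move=> [a k] [a' k'] _ _ /= [? ?]; congr (_, _); lia.
Qed.

Lemma size_caps : size caps = (2 * H.*2.+1)%N.
Proof. by rewrite size_allpairs size_iota. Qed.

Definition cap_event w := all (fun e => w e == (e == ((0, 0), false))) caps.
Definition mid_event w :=
  conn n l' j j (fun e => false (+) w (translate (1, - j%:Z) e)).
Definition top_event w :=
  conn n l j j (fun e => true (+) w (dual n.+1%:Z e)).
Definition bot_event w :=
  conn n l j j (fun e => true (+) w (dual (- H%:Z) e)).
(** An open tube between two dual paths of closed edges. The dual paths are
    one block longer than the tube, so that the tube ends inside the enclosed
    region. *)
Definition trap_event w :=
  [&& cap_event w, mid_event w, top_event w & bot_event w].

Definition trap_edges : seq edge := rect 0 (- H%:Z) l.+1 H.*2.+1.

Hypothesis jn : (j <= n)%N.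

(** An open path that starts at (1, 0) stays between the two walls and the two
    caps unless it takes the entrance. *)
Lemma tube_trap w : trap_event w ->
  exists D, trap w D (1 + l'%:Z) (l%:Z + 1) (l * H.*2.+1).
Proof.
case/and4P=> /allP capw /asboolP mid /wall[h1 [b1 t1 c1]] /wall[h2 [b2 t2 c2]].
have w0 : w ((0, 0), false).
  by have /(_ _)/eqP-> := capw ((0, 0), false); rewrite ?mem_caps //=; lia.
have wl (y : int) : - H%:Z <= y <= H%:Z -> ~~ w ((l%:Z, y), false).
  move=> hy; have /(_ _)/eqP-> := capw ((l%:Z, y), false).
    by rewrite !xpair_eqE; apply/negP => /andP[/andP[/eqP ? _] _]; rewrite /l /N2; lia.
  by rewrite mem_caps; lia.
have wr (y : int) : - H%:Z <= y <= H%:Z -> w ((0, y), false) -> y = 0.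
  move=> hy; have /(_ _)/eqP-> := capw ((0, y), false).
    by rewrite !xpair_eqE => /andP[/andP[_ /eqP]].
  by rewrite mem_caps; lia.
pose inv (x : vertex) := [&& 0 < x.1 <= l%:Z, h1 x & ~~ h2 x].
have inv_rows x : inv x -> - H%:Z < x.2 <= n.+1%:Z + n%:Z.
  move=> /and3P[xl hx1 hx2]; apply/andP; split;
    [rewrite ltNge|rewrite leNgt]; apply/negP => h.
    by have := b2 _ xl h; rewrite (negbTE hx2).
  by have := t1 _ xl; rewrite hx1; lia.
have inv10 : inv (1, 0).
  have xl : 0 < ((1, 0) : vertex).1 <= l%:Z by rewrite /= /l /N2; lia.
  by rewrite /inv xl b1 ?t2 //= /H; lia.
have inv_step x y : inv x -> open_adj w x y ->
    inv y \/ (x = (1, 0) :> vertex /\ y = (0, 0) :> vertex).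
  move=> ix xy; have ri := inv_rows _ ix; have /and3P[xl hx1 hx2] := ix.
  have [yl|yl] := boolP (0 < y.1 <= l%:Z).
    by left; rewrite /inv yl -(c1 _ _ xy) // -(c2 _ _ xy) // hx1.
  case: x y xy xl yl ri {ix hx1 hx2} => [x1 x2] [y1 y2] /open_adjP /=.
  case=> -[[? ?] wx] /=; subst => xl yl ri.
  - have E : x1 = l%:Z by lia.
    have /negP : ~~ w ((l%:Z, x2), false) by apply: wl; rewrite /H; lia.
    by rewrite -E.
  - right; have E : y1 = 0 by lia.
    by rewrite {}E in wx *; rewrite (wr y2) //; rewrite /H; lia.
  - lia.
  - lia.
pose box : seq vertex := [seq ((i%:Z + 1, k%:Z - H%:Z) : vertex) | i <- iota 0 l, k <- iota 0 H.*2.+1].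
pose D := [seq x <- box | `[< reach (keep inner w) (1, 0) x >]].
have ubox : uniq box.
  apply: allpairs_uniq; [exact: iota_uniq|exact: iota_uniq|].
  by move=> [i k] [i' k'] _ _ /= [? ?]; congr (_, _); lia.
have inv_reach x : reach (keep inner w) (1, 0) x -> inv x.
  apply: (reach_ind_inv (Q := fun x => inv x)) inv10 => u v iu uv.
  have uv' : open_adj w u v by apply: open_adj_mono uv => e /andP[].
  have [//|[Eu Ev]] := inv_step u v iu uv'.
  move: uv; rewrite Eu Ev => /open_adjP; rewrite /keep /inner /=.
  by case=> -[/eqP E W] //; move: E; rewrite xpair_eqE.
have boxD x : inv x -> x \in box.
  move=> ix; have := inv_rows _ ix; case/and3P: ix => xl _ _ xr.
  apply/allpairsP; exists (`|x.1 - 1|%N, absz (x.2 + H%:Z)).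
  rewrite !mem_iota /=; case: x xl xr => x1 x2 /= xl xr.
  by split; [lia|by move: xr; rewrite /H; lia|congr (_, _); lia].
have DP x : x \in D <-> reach (keep inner w) (1, 0) x.
  rewrite mem_filter; split; first by case/andP=> /asboolP.
  by move=> h; rewrite boxD ?andbT; [apply/asboolP|exact: inv_reach].
exists D; split.
- exact: filter_uniq.
- by rewrite size_filter (leq_trans (count_size _ _)) // size_allpairs !size_iota.
- exact/DP/reach_refl.
- exact: w0.
- by move=> x /DP/inv_reach/and3P[+ _ _]; lia.
- move=> x y /DP xD xy; have ix := inv_reach _ xD.
  have [iy|] := inv_step _ _ ix xy; last by right.
  left; apply/DP; apply: (reach_trans xD); apply: reach1.
  case/and3P: ix iy => xl _ _ /and3P[yl _ _].
  move: xy => /open_adjP h; apply/open_adjP; rewrite /keep /inner /=.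
  case: h => -[? ?]; [apply: Or41|apply: Or42|apply: Or43|apply: Or44];
    by (split=> //; apply/andP; split => //; lia).
- exists (1 + l'%:Z, 0) => //; apply/DP.
  have := reach_map (f := fun x => x + (1, - j%:Z)) (w' := keep inner w) _ mid.
  rewrite /=.
  have -> : (0, j%:Z) + (1, - j%:Z) = (1, 0) :> vertex.
    by congr (_, _) => /=; lia.
  have -> : (l'%:Z, j%:Z) + (1, - j%:Z) = (1 + l'%:Z, 0) :> vertex.
    by congr (_, _) => /=; lia.
  apply => u v; rewrite -open_adj_translate; apply: open_adj_mono => -[[a c] t].
  rewrite /keep /inner /translate /= => /andP[k ->]; rewrite andbT.
  by case: t k; lia.
- by move=> x /DP.
Qed.

(** Edges that a walk coming from the left has not met when it enters column
    0. The vertical edges of column 0 are left out because the conditioning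
    event may involve them. *)
Definition fresh : pred edge := fun e =>
  if e.2 then 0 < e.1.1 else 0 <= e.1.1.

Let Kcap e := e \in caps.
Let Kmid e := slab n l' (translate (- (1, - j%:Z)) e).
Let Ktop e := slab n l (undual n.+1%:Z e) && (dual n.+1%:Z (undual n.+1%:Z e) == e).
Let Kbot e := slab n l (undual (- H%:Z) e) && (dual (- H%:Z) (undual (- H%:Z) e) == e).

Let dcap : determined Kcap cap_event.
Proof. by move=> w w' ww; apply: eq_in_all => e /ww ->. Qed.

Let dmid : determined Kmid mid_event.
Proof.
apply: (determined_relabel false (@determined_conn n l' j j)) => e.
by rewrite /Kmid translateK.
Qed.

Let dtop : determined Ktop top_event.
Proof.
apply: (determined_relabel true (@determined_conn n l j j)) => e.
by rewrite /Ktop dualK eqxx andbT.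
Qed.

Let dbot : determined Kbot bot_event.
Proof.
apply: (determined_relabel true (@determined_conn n l j j)) => e.
by rewrite /Kbot dualK eqxx andbT.
Qed.

Lemma determined_trap_event :
  determined (fun e => (e \in trap_edges) && fresh e) trap_event.
Proof.
have h e : [|| Kcap e, Kmid e, Ktop e | Kbot e] -> (e \in trap_edges) && fresh e.
  case: e => -[a c] t; rewrite /Kcap /Kmid /Ktop /Kbot /fresh mem_caps mem_rect.
  by case: t => /=; rewrite /l /l' /N2 /H; lia.
move=> w w' ww; rewrite /trap_event.
rewrite (dcap (w' := w')) ?(dmid (w' := w')) ?(dtop (w' := w'))
  ?(dbot (w' := w')) // => e he; apply/ww/h; rewrite he ?orbT //.
Qed.

(** The caps, the tube and the two walls use disjoint sets of edges. *)
Lemma avg_trap_event (R : realType) (a : R) w : 0 <= a ->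
  (forall M, a ^+ M <= pconn n (n.+1.*2 * M) j j) ->
  (1/2) ^+ (2 * H.*2.+1) * a ^+ (M + M.+1 + M.+1) <=
  avg (1/2) trap_edges (fun w => (trap_event w)%:R) w.
Proof.
move=> a0 ha.
have E w' : (trap_event w')%:R = (cap_event w')%:R *
   ((mid_event w')%:R * ((top_event w')%:R * (bot_event w')%:R)) :> R.
  by rewrite -!natrM !mulnb.
rewrite (eq_avg _ _ E) {E}.
have us : uniq trap_edges by exact: uniq_rect.
pose toR (c : bool) : R := c%:R.
have dc := determined_comp toR dcap; have dm := determined_comp toR dmid.
have dt := determined_comp toR dtop; have db := determined_comp toR dbot.
have dtb : determined (fun e => Ktop e || Kbot e)
    (fun w => (top_event w)%:R * (bot_event w)%:R : R).
  move=> v v' vv; congr (_ * _); [apply: dt|apply: db] => e he; apply: vv;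
    by rewrite he ?orbT.
have dmtb : determined (fun e => [|| Kmid e, Ktop e | Kbot e])
    (fun w => (mid_event w)%:R * ((top_event w)%:R * (bot_event w)%:R) : R).
  move=> v v' vv; congr (_ * _); [apply: dm|apply: dtb] => e he; apply: vv;
    by rewrite he ?orbT.
rewrite (avg_indep _ _ _ dc dmtb); last first.
  move=> [[a' c] t]; rewrite /Kcap /Kmid /Ktop /Kbot mem_caps.
  by case: t => //=; rewrite /l /l' /N2 /H; lia.
rewrite (avg_indep _ _ _ dm dtb); last first.
  move=> [[a' c] t]; rewrite /Kmid /Ktop /Kbot.
  by case: t => //=; rewrite /l /l' /N2 /H; lia.
rewrite (avg_indep _ _ _ dt db); last first.
  move=> [[a' c] t]; rewrite /Ktop /Kbot.
  by case: t => //=; rewrite /l /l' /N2 /H; lia.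
have -> : avg (1/2) trap_edges (fun w => (cap_event w)%:R) w =
    (1/2) ^+ (2 * H.*2.+1) :> R.
  rewrite (avg_cylinder _ _ _ uniq_caps us).
    rewrite -size_caps; elim: caps => [|e s IH]; first by rewrite big_nil expr0.
    by rewrite big_cons IH exprS; congr (_ * _); case: ifP => _; field.
  move=> [[a' c] t]; rewrite mem_caps mem_rect.
  by case: t => //=; rewrite /l /l' /N2 /H; lia.
have -> : avg (1/2) trap_edges (fun w => (mid_event w)%:R) w = pconn n l' j j :> R.
  apply: (pconn_relabel false j j w (@translateK (1, - j%:Z)) us).
  move=> [[a' c] t] /=; rewrite /translate mem_rect.
  by case: t => //=; rewrite /l /l' /N2 /H; lia.
have -> : avg (1/2) trap_edges (fun w => (top_event w)%:R) w = pconn n l j j :> R.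
  apply: (pconn_relabel true j j w (@dualK n.+1%:Z) us).
  move=> [[a' c] t] /=.
  by case: t => //=; rewrite mem_rect /l /l' /N2 /H; lia.
have -> : avg (1/2) trap_edges (fun w => (bot_event w)%:R) w = pconn n l j j :> R.
  apply: (pconn_relabel true j j w (@dualK (- H%:Z)) us).
  move=> [[a' c] t] /=.
  by case: t => //=; rewrite mem_rect /l /l' /N2 /H; lia.
rewrite -addnA !exprD; apply: ler_wpM2l; first by apply: exprn_ge0; lra.
by apply: ler_pM; rewrite ?mulr_ge0 ?exprn_ge0 //; apply: ler_pM; rewrite ?exprn_ge0.
Qed.
End tube_trap.

(** * The walk as an electrical network *)

Lemma open_adj_neighbours w x y : open_adj w x y -> y \in neighbours x.
Proof.
rewrite /neighbours !inE; case: x y => [x1 x2] [y1 y2] /open_adjP.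
by rewrite !xpair_eqE /=; case=> -[[? ?] _] /=; subst; lia.
Qed.

Lemma uniq_neighbours x : uniq (neighbours x).
Proof.
by case: x => x1 x2; rewrite /neighbours /= !inE !xpair_eqE /=; lia.
Qed.

Lemma sum_neighbours {R : realType} w (D : seq vertex) x (F : vertex -> R) : uniq D ->
  (forall y, ~~ open_adj w x y -> F y = 0) ->
  \sum_(y <- neighbours x | y \in D) F y = \sum_(y <- D) F y.
Proof.
move=> uD F0; rewrite [RHS](bigID (fun y => y \in neighbours x)) /=.
rewrite [X in _ = _ + X]big1_seq ?addr0; last first.
  move=> y /andP[yn _]; apply: F0; apply: contra yn; exact: open_adj_neighbours.
rewrite -big_filter -[RHS]big_filter; apply: perm_big; apply: uniq_perm.
- exact/filter_uniq/uniq_neighbours.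
- exact: filter_uniq.
- by move=> y; rewrite !mem_filter andbC.
Qed.

Section reversible_walk.
Context {R : realType}.
Variables (beta : R) (w : edge -> bool).
Hypothesis beta1 : 1 < beta.

(** The biased walk is reversible: the horizontal edge that ends in column k
    and the vertical edges of column k have conductance beta^k. *)
Definition conductance (x y : vertex) : R :=
  if open_adj w x y then beta ^ Num.max x.1 y.1 else 0.

Definition weight (x : vertex) : R := \sum_(y <- neighbours x) conductance x y.

Let beta0 : 0 < beta. Proof. exact: lt_trans beta1. Qed.
Let betaz (z : int) : 0 < beta ^ z. Proof. exact: exprz_gt0. Qed.

Lemma conductance_ge0 x y : 0 <= conductance x y.
Proof. by rewrite /conductance; case: ifP => // _; exact/ltW. Qed.

Lemma conductance_sym x y : conductance x y = conductance y x.
Proof. by rewrite /conductance open_adj_sym maxC. Qed.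

Lemma weight_ge0 x : 0 <= weight x.
Proof. by apply: sumr_ge0 => y _; exact: conductance_ge0. Qed.

Lemma weightE x : weight x = beta ^ x.1 *
  (if open_adj w x (x + e1) then beta + (open_degree w x)%:R - 1
   else (open_degree w x)%:R).
Proof.
rewrite /weight /open_degree /neighbours !big_cons big_nil /conductance /=.
have -> : Num.max x.1 (x + e1).1 = x.1 + 1 by rewrite /=; lia.
have -> : Num.max x.1 (x - e1).1 = x.1 by rewrite /=; lia.
have -> : Num.max x.1 (x + e2).1 = x.1 by rewrite /=; lia.
rewrite !addn0 !natrD expfzDr ?gt_eqF // expr1z.
by do 4?[case: ifP => _]; rewrite /=; ring.
Qed.

Lemma transitionE x y : transition beta w x y = conductance x y / weight x.
Proof.
rewrite /transition weightE /conductance.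
case: ifPn; rewrite ?negbK => xy; first by rewrite (negbTE xy) mul0r.
rewrite xy; have b1 := betaz x.1.
have deg : (0 < open_degree w x)%N.
  by rewrite -has_count; apply/hasP; exists y => //; exact: (open_adj_neighbours xy).
have deg1 : 1 <= (open_degree w x)%:R :> R by rewrite ler1n.
have E : Num.max x.1 y.1 = if y == x + e1 then x.1 + 1 else x.1.
  move: xy; case: x y {b1 deg deg1} => [x1 x2] [y1 y2] /open_adjP.
  by rewrite xpair_eqE /=; case=> -[[? ?] _] /=; subst; case: ifP; lia.
have b1' : beta ^ x.1 != 0 by exact: lt0r_neq0.
case: ifP => r; rewrite E invfM mulrA; congr (_ / _).
  case: ifP => _; last by rewrite divff.
  by rewrite expfzDr ?gt_eqF // expr1z mulrAC divff ?mul1r.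
by case: eqP => [yx|_]; [rewrite -yx xy in r|rewrite divff].
Qed.

Lemma transition_ge0 x y : 0 <= transition beta w x y.
Proof. by rewrite transitionE divr_ge0 ?conductance_ge0 ?weight_ge0. Qed.

Lemma sum_transition_le1 x : \sum_(y <- neighbours x) transition beta w x y <= 1.
Proof.
under eq_bigr do rewrite transitionE.
rewrite -mulr_suml -/(weight x); have [->|h] := eqVneq (weight x) 0.
  by rewrite mul0r.
by rewrite divff.
Qed.

Lemma weight_transition x y : weight x * transition beta w x y = conductance x y.
Proof.
rewrite transitionE; have [h|h] := eqVneq (weight x) 0; last first.
  by rewrite mulrC divfK.
rewrite h mul0r; apply/eqP; rewrite eq_le conductance_ge0 andTb.
have [xy|xy] := boolP (open_adj w x y); last by rewrite /conductance (negbTE xy).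
rewrite -h /weight (big_rem y) ?(open_adj_neighbours xy) //= lerDl.
by apply: sumr_ge0 => z _; exact: conductance_ge0.
Qed.

Lemma transition_lb x y : open_adj w x y -> 1 / (beta + 3) <= transition beta w x y.
Proof.
move=> xy; rewrite /transition xy /=.
have deg : (0 < open_degree w x)%N.
  by rewrite -has_count; apply/hasP; exists y => //; exact: (open_adj_neighbours xy).
have deg1 : 1 <= (open_degree w x)%:R :> R by rewrite ler1n.
have deg4 : (open_degree w x)%:R <= 4 :> R.
  by rewrite ler_nat (leq_trans (count_size _ _)).
move: ((open_degree w x)%:R : R) deg1 deg4 => c c1 c4; have b1 := beta1.
case: ifP => _.
  apply: ler_pM => //; first by rewrite invr_ge0; lra.
    by case: ifP => _; lra.
  by rewrite lef_pV2 ?posrE; lra.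
by rewrite !mul1r lef_pV2 ?posrE; lra.
Qed.

Lemma transition_right_lb x : open_adj w x (x + e1) ->
  1 / 4 <= transition beta w x (x + e1).
Proof.
move=> xy; rewrite /transition xy /= eqxx.
have deg : (0 < open_degree w x)%N.
  by rewrite -has_count; apply/hasP; exists (x + e1) => //; exact: (open_adj_neighbours xy).
have deg1 : 1 <= (open_degree w x)%:R :> R by rewrite ler1n.
have deg4 : (open_degree w x)%:R <= 4 :> R.
  by rewrite ler_nat (leq_trans (count_size _ _)).
move: ((open_degree w x)%:R : R) deg1 deg4 => c c1 c4; have b1 := beta1.
by rewrite ler_pdivlMr; lra.
Qed.

Lemma weight_lb x y : open_adj w x y -> beta ^ x.1 <= weight x.
Proof.
move=> xy; rewrite /weight (big_rem y) ?(open_adj_neighbours xy) //=.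
apply: (@le_trans _ _ (conductance x y)); last first.
  by rewrite lerDl; apply: sumr_ge0 => z _; exact: conductance_ge0.
by rewrite /conductance xy ler_weXz2l ?(ltW beta1) // le_max lexx.
Qed.

(** Mean of theta^n phi(Z_n), where n is the first time, if it is at most N,
    at which the walk reaches column a. *)
Fixpoint hit (theta : R) (a : int) (phi : vertex -> R) (N : nat) (x : vertex) : R :=
  if a <= x.1 then phi x else
  if N is N'.+1 then
    theta * \sum_(y <- neighbours x) transition beta w x y * hit theta a phi N' y
  else 0.

(** Comparison with a supersolution U of the discounted equation. *)
Lemma hit_le (theta : R) a phi (U : vertex -> R) N x : 0 <= theta ->
  (forall x, 0 <= U x) -> (forall x, a <= x.1 -> phi x <= U x) ->
  (forall x, x.1 < a ->
     theta * \sum_(y <- neighbours x) transition beta w x y * U y <= U x) ->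
  hit theta a phi N x <= U x.
Proof.
move=> t0 U0 Ua Us; elim: N x => [|N IH] x /=; case: ifPn => [/Ua //|].
  by [].
rewrite -ltNge => /Us; apply: le_trans; apply: ler_wpM2l => //.
by apply: ler_sum => y _; apply: ler_wpM2l => //; exact: transition_ge0.
Qed.

Lemma hit_ge0 (theta : R) a phi N x : 0 <= theta -> (forall x, 0 <= phi x) ->
  0 <= hit theta a phi N x.
Proof.
move=> t0 p0; elim: N x => [|N IH] x /=; case: ifP => // _.
rewrite mulr_ge0 // sumr_ge0 // => y _; rewrite mulr_ge0 //.
exact: transition_ge0.
Qed.

End reversible_walk.

(** * Delay in a trap *)

Lemma exists_expr_le_half {R : realType} (r : R) : 0 <= r < 1 ->
  exists k, r ^+ k <= 1 / 2.
Proof.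
move=> /andP[r0 r1].
have h : (r ^+ k) @[k --> \oo] --> (0 : R).
  by apply: cvg_expr; rewrite ger0_norm.
have h2 : 0 < 1 / 2 :> R by lra.
move/cvgrPdist_le : h => /(_ _ h2)[k _ hk].
exists k; have := hk k (leqnn k); rewrite sub0r normrN ger0_norm //.
exact: exprn_ge0.
Qed.

Section trap_delay.
Context {R : realType}.
Variables (beta : R) (w : edge -> bool) (D : seq vertex) (m L : int) (B : nat).
Hypotheses (beta1 : 1 < beta) (tD : trap w D m L B).

Local Ltac blra := (have ? := beta1); lra.
Local Notation p := (transition beta w).
Local Notation c := (conductance beta w).
Local Notation weight := (weight beta w).

(** Probability that the walk started at x spends its next N steps in D. *)
Fixpoint stay (N : nat) (x : vertex) : R :=
  if N is N'.+1 then \sum_(y <- neighbours x | y \in D) p x y * stay N' y else 1.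

Let p_ge0 x y : 0 <= p x y. Proof. exact: transition_ge0. Qed.

Lemma stay_ge0 N x : 0 <= stay N x.
Proof.
elim: N x => //= N IH x; apply: sumr_ge0 => y _; exact: mulr_ge0.
Qed.

Lemma stay_succ N x : stay N.+1 x <= stay N x.
Proof.
elim: N x => [|N IH] x.
  rewrite /= (le_trans _ (sum_transition_le1 w beta1 x)) //.
  rewrite [leRHS](bigID (mem D)) /= -[leLHS]addr0 lerD ?sumr_ge0 //.
  by apply: ler_sum => y _; rewrite mulr1.
by apply: ler_sum => y _; apply: ler_wpM2l => //; exact: IH.
Qed.

Lemma stay_anti N k x : stay (N + k) x <= stay N x.
Proof.
elim: k => [|k IH]; first by rewrite addn0.
by rewrite addnS (le_trans (stay_succ _ _)).
Qed.

Lemma stay_le1 N x : stay N x <= 1.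
Proof. by have := stay_anti 0 N x; rewrite add0n. Qed.

(** By reversibility, the sum of stay against the weights loses in one step
    only what flows through the entrance, an edge of conductance beta. *)
Lemma weighted_stay_step N :
  (\sum_(x <- D) weight x * stay N x) - beta * stay N (1, 0) <=
  \sum_(x <- D) weight x * stay N.+1 x.
Proof.
have cb x y : ~~ open_adj w x y -> c x y = 0.
  by rewrite /conductance => /negbTE ->.
have -> : \sum_(x <- D) weight x * stay N.+1 x =
    \sum_(y <- D) (\sum_(x <- D) c y x) * stay N y.
  under [RHS]eq_bigr do rewrite mulr_suml.
  rewrite exchange_big /=; apply: eq_bigr => x _.
  rewrite mulr_sumr.
  rewrite -(sum_neighbours (trap_uniq tD) (w := w) (x := x)); last first.
    by move=> y xy; rewrite conductance_sym cb // mul0r.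
  by apply: eq_bigr => y _; rewrite mulrA weight_transition // conductance_sym.
have -> : beta * stay N (1, 0) =
    \sum_(y <- D) (if y == (1, 0) then beta else 0) * stay N y.
  rewrite (big_rem _ (trap_entrance tD)) /= ?eqxx big1_seq ?addr0 // => y /andP[_].
  by rewrite mem_rem_uniq ?(trap_uniq tD) // inE => /andP[/negbTE -> _]; rewrite mul0r.
rewrite -sumrB; rewrite big_seq [leRHS]big_seq; apply: ler_sum => y yD.
rewrite -mulrBl; apply: ler_wpM2r; first exact: stay_ge0.
rewrite lerBlDr -(sum_neighbours (trap_uniq tD) (w := w) (x := y) (cb y)).
rewrite /weight (bigID (mem D)) /= lerD2l.
case: eqP => [->|ny]; last first.
  apply: sumr_le0 => x xD; rewrite /conductance; case: ifP => // xy.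
  by have [|[]//] := trap_closed tD yD xy; rewrite (negbTE xD).
rewrite big_seq_cond.
apply: (@le_trans _ _ (\sum_(x <- neighbours (1, 0)) (if x == (0, 0) then beta else 0))).
  rewrite [leRHS]big_seq [leRHS](bigID [predC mem D]) /=.
  apply: (@le_trans _ _ (\sum_(i <- neighbours (1, 0) | (i \in neighbours (1, 0)) && (i \notin D))
     (if i == (0, 0) then beta else 0))); last first.
    by rewrite lerDl; apply: sumr_ge0 => x _; case: ifP => // _; blra.
  apply: ler_sum => x /andP[_ xD]; rewrite /conductance; case: ifP => xy; last first.
    by case: ifP => _; blra.
  have [|[_ ->]] := trap_closed tD (trap_entrance tD) xy; first by rewrite (negbTE xD).
  by rewrite eqxx /= expr1z.
by rewrite /neighbours !big_cons big_nil /=; rewrite !addr0 ?add0r.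
Qed.

(** Truncated form of the formula of Kac: the mean time spent in D by an
    excursion from the origin is the weight of D divided by the conductance of
    the entrance. *)
Lemma kac M : \sum_(x <- D) weight x * (1 - stay M x) <=
  beta * \sum_(N < M) stay N (1, 0).
Proof.
elim: M => [|M IH].
  by rewrite big_ord0 mulr0 big1 // => x _; rewrite subrr mulr0.
have -> : \sum_(N < M.+1) stay N (1, 0) = \sum_(N < M) stay N (1, 0) + stay M (1, 0).
  by rewrite big_ord_recr.
rewrite mulrDr; have := weighted_stay_step M.
have E N : \sum_(x <- D) weight x * (1 - stay N x) =
    \sum_(x <- D) weight x - \sum_(x <- D) weight x * stay N x.
  by rewrite -sumrB; apply: eq_bigr => x _; ring.
by move: IH; rewrite !E; blra.
Qed.

Let d : R := 1 / (beta + 3).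
Let d01 : 0 < d < 1.
Proof.
apply/andP; split; first by apply: divr_gt0; blra.
by rewrite /d ltr_pdivrMr; blra.
Qed.

(** The chance of leaving D that is gained at z, in proportion eta, is felt at
    x in proportion d * eta, since the walk steps from x to z with probability
    at least d. *)
Lemma stay_step (N : nat) (rho eta : R) x z : 0 <= rho -> 0 <= eta <= 1 ->
  (forall y, y \in D -> stay N y <= rho) -> open_adj w x z ->
  (z \in D -> stay N z <= rho * (1 - eta)) ->
  stay N.+1 x <= rho * (1 - d * eta).
Proof.
move=> r0 /andP[e0 e1] h xz hz.
apply: (@le_trans _ _ (\sum_(y <- neighbours x)
    p x y * (rho - (if y == z then rho * eta else 0)))).
  rewrite /= big_mkcond; apply: ler_sum => y _.
  have re : rho * eta <= rho by rewrite ler_piMr.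
  case: ifP => yD; last first.
    by apply: mulr_ge0 => //; case: ifP => _; blra.
  apply: ler_wpM2l => //; case: eqP => [yz|_]; last by rewrite subr0 h.
  by have := hz; rewrite -yz => /(_ yD); blra.
have -> : \sum_(y <- neighbours x) p x y * (rho - (if y == z then rho * eta else 0)) =
   (\sum_(y <- neighbours x) p x y) * rho - p x z * (rho * eta).
  have -> : p x z * (rho * eta) =
      \sum_(y <- neighbours x) p x y * (if y == z then rho * eta else 0).
    rewrite (big_rem z) ?(open_adj_neighbours xz) // eqxx big1_seq; first by rewrite /= addr0.
    move=> y /andP[_].
    rewrite mem_rem_uniq ?uniq_neighbours // inE => /andP[/negbTE -> _].
    by rewrite mulr0.
  by rewrite mulr_suml -sumrB; apply: eq_bigr => y _; ring.
have h1 := sum_transition_le1 w beta1 x.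
have h2 : d <= p x z by exact: transition_lb.
have h3 : (\sum_(y <- neighbours x) p x y) * rho <= 1 * rho by exact: ler_wpM2r.
have h4 : d * (rho * eta) <= p x z * (rho * eta).
  by apply: ler_wpM2r => //; exact: mulr_ge0.
blra.
Qed.

Lemma trap_inner_path s : path (open_adj (keep inner w)) (1, 0) s ->
  {subset (1, 0) :: s <= D}.
Proof.
elim/last_ind: s => [_ x|s z IH].
  by rewrite inE => /eqP ->; exact: trap_entrance tD.
rewrite rcons_path => /andP[ps lz] x; rewrite -rcons_cons mem_rcons inE.
case/orP => [/eqP ->|/(IH ps) //].
have lD : last (1, 0) s \in D by apply: (IH ps); exact: mem_last.
have lz' : open_adj w (last (1, 0) s) z by apply: open_adj_mono lz => e /andP[].
have [//|[E1 E2]] := trap_closed tD lD lz'.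
move: lz; rewrite E1 E2 => /open_adjP; rewrite /keep /inner /=.
by case=> -[/eqP E W] //; move: E; rewrite xpair_eqE.
Qed.

(** The walk may follow an inner path back to the entrance and leave. *)
Lemma stay_path (N : nat) (rho : R) s j : 0 <= rho ->
  (forall y, y \in D -> stay N y <= rho) ->
  path (open_adj (keep inner w)) (1, 0) s ->
  stay (N + (size s).+1 + j) (last (1, 0) s) <= rho * (1 - d ^+ (size s).+1).
Proof.
move=> r0 h; have {}h k y : y \in D -> stay (N + k) y <= rho.
  by move=> /h; apply: le_trans; exact: stay_anti.
have [d0 d1] := andP d01.
elim/last_ind: s j => [|s z IH] j.
  move=> _; rewrite addn1 addSn expr1 -[d]mulr1.
  apply: (stay_step (z := (0, 0))) => //; first by rewrite ler01 lexx.
  - by move=> y; exact: h.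
  - by apply/open_adjP; apply: Or42; split => //; exact: trap_open tD.
  - by move=> /(trap_columns tD).
rewrite rcons_path last_rcons size_rcons => /andP[ps lz].
rewrite addnS addSn exprS.
have lz' : open_adj w (last (1, 0) s) z by apply: open_adj_mono lz => e /andP[].
apply: (stay_step (z := last (1, 0) s)) => //.
- by rewrite exprn_ge0 ?(ltW d0) //= exprn_ile1 ?(ltW d0) ?(ltW d1).
- by move=> y yD; rewrite -addnA h.
- by rewrite open_adj_sym.
- by move=> _; exact: IH.
Qed.

Lemma stay_round (N : nat) (rho : R) x : 0 <= rho ->
  (forall y, y \in D -> stay N y <= rho) -> x \in D ->
  stay (N + B) x <= rho * (1 - d ^+ B).
Proof.
move=> r0 h xD; have [s ps ls] := trap_connected tD xD.
have [d0 d1] := andP d01.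
case/shortenP: ps ls => s' ps' us' _ ls'.
have sB : ((size s').+1 <= B)%N.
  rewrite (leq_trans _ (trap_size tD)) //.
  exact: (uniq_leq_size us' (trap_inner_path ps')).
have := stay_path (B - (size s').+1) r0 h ps'; rewrite ls' -addnA subnKC //.
move/le_trans; apply; apply: ler_wpM2l => //; rewrite lerD2l lerN2.
by apply: ler_wiXn2l => //; exact: ltW.
Qed.

Lemma stay_rounds k x : x \in D -> stay (B * k) x <= (1 - d ^+ B) ^+ k.
Proof.
have [d0 d1] := andP d01.
have q0 : 0 <= 1 - d ^+ B by rewrite subr_ge0 exprn_ile1 ?(ltW d0) ?(ltW d1).
elim: k x => [|k IH] x xD; first by rewrite muln0 expr0.
rewrite mulnS addnC exprSr; apply: stay_round => //.
exact: exprn_ge0.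
Qed.

Lemma trap_deep_weight : exists2 z, z \in D & beta ^ m <= weight z.
Proof.
have [z zD mz] := trap_deep tD; exists z => //.
apply: (@le_trans _ _ (beta ^ z.1)); first by rewrite ler_weXz2l // ltW.
have [s ps ls] := trap_connected tD zD.
case/lastP: s ps ls => [_ /= <-|s z'].
  apply: (@weight_lb _ _ _ beta1 _ (0, 0)).
  by apply/open_adjP; apply: Or42; split => //; exact: trap_open tD.
rewrite rcons_path last_rcons => /andP[_ lz] <-.
apply: (@weight_lb _ _ _ beta1 _ (last (1, 0) s)); rewrite open_adj_sym.
by apply: open_adj_mono lz => e /andP[].
Qed.

Let f M x : R := \sum_(N < M) stay N x.

(** Let f be the mean of the exit time from D truncated at M. One step lowers
    f by at most 1, hence 1 - k f with k = (1 - theta) / 2 is a supersolution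
    of the discounted equation on D. By the formula of Kac, f (1, 0) is at
    least beta^m / (2 beta) as soon as the walk has left D by time M with
    probability at least 1/2. *)
Lemma trap_delay (M : nat) (theta : R) (a : int) N :
  (forall x, x \in D -> stay M x <= 1 / 2) ->
  0 <= theta < 1 -> (1 - theta) * M%:R <= 1 -> L <= a ->
  hit beta w theta a (fun=> 1) N (0, 0) <=
  1 - (1 - theta) * (beta ^ m / (16 * beta)).
Proof.
move=> hM /andP[t0 t1] tM La.
have fM x : f M x <= M%:R.
  apply: (@le_trans _ _ (\sum_(i < M) 1)); last by rewrite sumr_const card_ord.
  by apply: ler_sum => i _; exact: stay_le1.
have f0 x : 0 <= f M x by apply: sumr_ge0 => i _; exact: stay_ge0.
have deep : beta ^ m / (2 * beta) <= f M (1, 0).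
  have [z zD hz] := trap_deep_weight.
  have := kac M; rewrite (big_rem z) //=.
  have : 0 <= \sum_(y <- rem z D) weight y * (1 - stay M y).
    apply: sumr_ge0 => y _; apply: mulr_ge0; first exact: weight_ge0.
    by rewrite subr_ge0 stay_le1.
  have : beta ^ m * (1 / 2) <= weight z * (1 - stay M z).
    apply: ler_pM => //; try blra; first by rewrite exprz_ge0 //; blra.
    by have := hM _ zD; blra.
  rewrite -/(f M (1, 0)) => h1 h2 h3.
  by rewrite ler_pdivrMr; blra.
pose k := (1 - theta) / 2.
have kf x : k * f M x <= 1 / 2.
  have : (1 - theta) * f M x <= 1 * 1.
    rewrite mul1r; apply: le_trans tM; apply: ler_wpM2l => //; blra.
  by rewrite /k; blra.
have kf0 x : 0 <= k * f M x by apply: mulr_ge0 => //; rewrite /k; blra.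
pose U x := if x \in D then 1 - k * f M x else 1.
have U01 x : 0 <= U x <= 1.
  by rewrite /U; case: ifP => _; have := kf x; have := kf0 x; blra.
have hU n x : hit beta w theta a (fun=> 1) n x <= U x.
  apply: hit_le => // {}x.
  - by case/andP: (U01 x).
  - rewrite /U; case: ifP => // xD; have := trap_columns tD xD; lia.
  - move=> xa.
    have sU : \sum_(y <- neighbours x) p x y * U y <= 1.
      rewrite (le_trans _ (sum_transition_le1 w beta1 x)) //.
      apply: ler_sum => y _; rewrite ler_piMr //; by case/andP: (U01 y).
    have sU0 : 0 <= \sum_(y <- neighbours x) p x y * U y.
      apply: sumr_ge0 => y _; apply: mulr_ge0 => //; by case/andP: (U01 y).
    rewrite {2}/U; case: ifP => xD; last by rewrite mulr_ile1 //; blra.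
    have Pf : f M x - 1 <= \sum_(y <- neighbours x | y \in D) p x y * f M y.
      have -> : \sum_(y <- neighbours x | y \in D) p x y * f M y =
          \sum_(i < M) stay i.+1 x.
        by under eq_bigr do rewrite mulr_sumr; rewrite exchange_big.
      have : f M x + stay M x = 1 + \sum_(i < M) stay i.+1 x.
        by rewrite /f -(big_ord_recr M (fun i => stay i x)) big_ord_recl.
      by have := stay_ge0 M x; blra.
    have : \sum_(y <- neighbours x) p x y * U y <= 1 - k * (f M x - 1).
      have -> : \sum_(y <- neighbours x) p x y * U y =
         \sum_(y <- neighbours x) p x y -
         k * \sum_(y <- neighbours x | y \in D) p x y * f M y.
        rewrite mulr_sumr [in X in _ - X]big_mkcond -sumrB; apply: eq_bigr => y _.
        by rewrite /U; case: ifP => _; ring.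
      have := sum_transition_le1 w beta1 x.
      have : k * (f M x - 1) <= k * \sum_(y <- neighbours x | y \in D) p x y * f M y.
        by apply: ler_wpM2l => //; rewrite /k; blra.
      blra.
    move=> h; apply: le_trans (ler_wpM2l t0 h) _.
    move: (kf x) (kf0 x); set F := k * f M x => F1 F2.
    have -> : k * (f M x - 1) = F - k by rewrite /F; ring.
    rewrite /k; nra.
have La' : (a <= 0) = false.
  by have := trap_columns tD (trap_entrance tD); move: La; rewrite /=; lia.
have bm0 : 0 < beta ^ m by apply: exprz_gt0; blra.
have E16 : beta ^ m / (16 * beta) = (beta ^ m / (2 * beta)) / 8.
  by field; apply: lt0r_neq0; blra.
have ub : k * (beta ^ m / (2 * beta)) <= 1 / 2.
  apply: le_trans (kf (1, 0)); apply: ler_wpM2l => //; rewrite /k; blra.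
case: N => [|N] /=; rewrite La'.
  by rewrite E16; move: ub; rewrite /k; blra.
have o1 : open_adj w (0, 0) ((0, 0) + e1).
  by apply/open_adjP; apply: Or41; split => //; exact: trap_open tD.
have e1E : (0, 0) + e1 = (1, 0) :> vertex by [].
have := transition_right_lb beta1 o1; rewrite e1E => p4.
have s1 : \sum_(y <- neighbours (0, 0)) p (0, 0) y * hit beta w theta a (fun=> 1) N y
    <= 1 - 1 / 4 * (k * f M (1, 0)).
  apply: (@le_trans _ _ (\sum_(y <- neighbours (0, 0)) p (0, 0) y * U y)).
    by apply: ler_sum => y _; apply: ler_wpM2l.
  apply: (@le_trans _ _ (\sum_(y <- neighbours (0, 0)) p (0, 0) y -
       p (0, 0) (1, 0) * (k * f M (1, 0)))).
    have split_sum (F : vertex -> R) : \sum_(y <- neighbours (0, 0)) F y =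
        F (1, 0) + \sum_(y <- rem (1, 0) (neighbours (0, 0))) F y.
      by rewrite (big_rem (1, 0)) ?(open_adj_neighbours o1).
    rewrite !split_sum.
    rewrite {1}/U (trap_entrance tD).
    have : \sum_(y <- rem (1, 0) (neighbours (0, 0))) p (0, 0) y * U y <=
        \sum_(y <- rem (1, 0) (neighbours (0, 0))) p (0, 0) y.
      by apply: ler_sum => y _; rewrite ler_piMr //; case/andP: (U01 y).
    blra.
  have := sum_transition_le1 w beta1 (0, 0).
  have := ler_wpM2r (kf0 (1, 0)) p4; blra.
apply: (@le_trans _ _ (1 - 1 / 4 * (k * f M (1, 0)))).
  apply: le_trans (ler_wpM2l t0 s1) _; rewrite ler_piMl //; last blra.
  by have := kf (1, 0); blra.
have := ler_wpM2l (_ : 0 <= k) deep; rewrite E16 /k => h.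
by have := h _; blra.
Qed.

End trap_delay.

(** The discount theta0 depends on the trap only through the bound B on its
    size, hence serves all configurations at once. *)
Lemma trap_slows {R : realType} (beta : R) (B : nat) : 1 < beta ->
  exists2 theta0 : R, 0 <= theta0 < 1 & forall theta, theta0 <= theta < 1 ->
  forall w D m L (a : int) N, trap w D m L B -> L <= a ->
  hit beta w theta a (fun=> 1) N (0, 0) <=
  1 - (1 - theta) * (beta ^ m / (16 * beta)).
Proof.
move=> b1; pose d : R := 1 / (beta + 3).
have d0 : 0 < d by apply: divr_gt0; lra.
have d1 : d < 1 by rewrite /d ltr_pdivrMr; lra.
have [k hk] : exists k, (1 - d ^+ B) ^+ k <= 1 / 2.
  apply: exists_expr_le_half; rewrite subr_ge0 ltrBlDr ltrDl exprn_gt0 // andbT.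
  by rewrite exprn_ile1 // ltW.
have [M M1 h'] : exists2 M : R, 1 <= M & (B * k)%:R <= M.
  by exists ((B * k).+1)%:R; rewrite ?ler1n ?ler_nat.
have M0 : 0 < M by lra.
exists (1 - M^-1).
  rewrite subr_ge0 invf_le1 // M1 ltrBlDr ltrDl invr_gt0 //.
move=> theta /andP[t0 t1] w D m L a N tD La.
have : 0 <= 1 - M^-1 by rewrite subr_ge0 invf_le1.
move=> Mi; apply: (trap_delay b1 tD _ (M := (B * k)%N)) => //.
- move=> x xD; apply: le_trans hk; exact: (stay_rounds b1 tD).
- by rewrite t1 andbT; exact: le_trans Mi t0.
- have h : (1 - theta) <= M^-1 by lra.
  apply: (@le_trans _ _ (M^-1 * M)); last by rewrite mulVf // lt0r_neq0.
  by apply: ler_pM => //; lra.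
Qed.

(** * Finite trajectories *)

Section path_expectation.
Context {R : realType}.
Variable (beta : R).
Hypothesis beta1 : 1 < beta.

Lemma transition_translate w v x y :
  transition beta (fun e => w (translate v e)) x y = transition beta w (x + v) (y + v).
Proof.
have deg : open_degree (fun e => w (translate v e)) x = open_degree w (x + v).
  rewrite /open_degree /neighbours /= !open_adj_translate.
  by rewrite ![_ + v + _]addrAC.
rewrite /transition deg !open_adj_translate ![_ + v + e1]addrAC.
by rewrite (inj_eq (addIr v)).
Qed.

Lemma hit_translate w v theta a phi N x :
  hit beta w theta a phi N (x + v) =
  hit beta (fun e => w (translate v e)) theta (a - v.1) (fun x => phi (x + v)) N x.
Proof.
elim: N x => [|N IH] x /=; rewrite lerBlDr //.
case: ifP => // _; congr (_ * _).
have -> : neighbours (x + v) = [seq y + v | y <- neighbours x].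
  by rewrite /neighbours /= ![_ + v + _]addrAC.
by rewrite big_map; apply: eq_bigr => y _; rewrite IH transition_translate.
Qed.

(** Mean of E over the first N + 1 positions of the walk started at x. *)
Fixpoint path_mean (w : edge -> bool) (N : nat) (x : vertex) (E : seq vertex -> R) : R :=
  if N is N'.+1 then
    \sum_(y <- neighbours x)
       transition beta w x y * path_mean w N' y (fun s => E (x :: s))
  else E [:: x].

Lemma path_mean_ge0 w N x E : (forall s, 0 <= E s) -> 0 <= path_mean w N x E.
Proof.
elim: N x E => [|N IH] x E h /=; first exact: h.
by apply: sumr_ge0 => y _; apply: mulr_ge0; [exact: transition_ge0|exact: IH].
Qed.

Lemma path_mean_le1 w N x E : (forall s, 0 <= E s <= 1) -> path_mean w N x E <= 1.
Proof.
elim: N x E => [|N IH] x E h /=; first by case/andP: (h [:: x]).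
rewrite (le_trans _ (sum_transition_le1 w beta1 x)) //; apply: ler_sum => y _.
by rewrite ler_piMr ?transition_ge0 // IH.
Qed.

(** A hitting time that is at most N is discounted by at least theta^N. *)
Lemma path_mean_hit w theta (a : int) N x : 0 <= theta <= 1 ->
  theta ^+ N * path_mean w N x (fun s => (has (fun y => a <= y.1) s)%:R) <=
  hit beta w theta a (fun=> 1) N x.
Proof.
move=> /andP[t0 t1]; elim: N x => [|N IH] x.
  by rewrite expr0 mul1r /=; case: ifP.
have [xa|xa] := boolP (a <= x.1).
  rewrite [X in _ <= X](_ : _ = 1); last by rewrite /= xa.
  rewrite mulr_ile1 ?exprn_ge0 ?exprn_ile1 //.
    by apply: (@path_mean_ge0 w N.+1 x) => s.
  by apply: (@path_mean_le1 w N.+1 x) => s; case: (has _ s); rewrite ?lexx ?ler01.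
rewrite /= (negbTE xa) /= exprS -mulrA; apply: ler_wpM2l => //.
rewrite mulr_sumr; apply: ler_sum => y _; rewrite mulrCA.
by apply: ler_wpM2l; [exact: transition_ge0|exact: IH].
Qed.

Fixpoint step_iter (w : edge -> bool) (N : nat) (g : vertex -> R) (x : vertex) : R :=
  if N is N'.+1 then
    \sum_(y <- neighbours x) transition beta w x y * step_iter w N' g y
  else g x.

Lemma path_mean_last w N (g : vertex -> R) x x0 :
  path_mean w N x (fun s => g (last x0 s)) = step_iter w N g x.
Proof. by elim: N x x0 => //= N IH x x0; apply: eq_bigr => y _; rewrite IH. Qed.

Definition box (n : nat) : seq vertex :=
  [seq (i%:Z - n%:Z, j%:Z - n%:Z) | i <- iota 0 n.*2.+1, j <- iota 0 n.*2.+1].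

Lemma mem_box n (x1 x2 : int) : ((x1, x2) \in box n) =
  (- n%:Z <= x1 <= n%:Z) && (- n%:Z <= x2 <= n%:Z).
Proof.
apply/idP/idP.
  move=> /allpairsP[[i j] [+ + [-> ->]]]; rewrite !mem_iota /=; lia.
move=> h; apply/allpairsP; exists (absz (x1 + n%:Z), absz (x2 + n%:Z)).
by rewrite !mem_iota /=; split; [lia|lia|congr (_, _); lia].
Qed.

Lemma uniq_box n : uniq (box n).
Proof.
apply: allpairs_uniq; [exact: iota_uniq|exact: iota_uniq|].
by move=> [i j] [i' j'] _ _ /= [? ?]; congr (_, _); lia.
Qed.

Lemma size_box n : size (box n) = (n.*2.+1 * n.*2.+1)%N.
Proof. by rewrite size_allpairs !size_iota. Qed.

(** The weights form a stationary measure, so a step of the walk does not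
    increase the weighted sum of a nonnegative function. Finite sums require a
    box that grows by one at each step. *)
Lemma step_iter_weight w N n (g : vertex -> R) : (forall x, 0 <= g x) ->
  \sum_(x <- box n) weight beta w x * step_iter w N g x <=
  \sum_(x <- box (n + N)) weight beta w x * g x.
Proof.
move=> g0; elim: N n => [|N IH] n; first by rewrite addn0.
have it0 x : 0 <= step_iter w N g x.
  by rewrite -(path_mean_last _ _ _ _ 0) path_mean_ge0.
rewrite addnS -addSn; apply: le_trans (IH n.+1).
have c0 := conductance_ge0 w beta1.
have -> : \sum_(x <- box n) weight beta w x * step_iter w N.+1 g x =
    \sum_(y <- box n.+1) (\sum_(x <- box n) conductance beta w y x) * step_iter w N g y.
  under [RHS]eq_bigr do rewrite mulr_suml.
  rewrite exchange_big /=; rewrite big_seq [RHS]big_seq; apply: eq_bigr => x xn.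
  rewrite mulr_sumr -(sum_neighbours (uniq_box n.+1) (w := w) (x := x)); last first.
    move=> y xy; rewrite conductance_sym // /conductance (negbTE xy) mul0r //.
  rewrite [RHS]big_mkcond; rewrite big_seq [RHS]big_seq; apply: eq_bigr => y yx.
  have -> : y \in box n.+1.
    case: x y xn yx => [x1 x2] [y1 y2]; rewrite !mem_box /neighbours !inE !xpair_eqE /=.
    lia.
  by rewrite mulrA weight_transition // conductance_sym.
apply: ler_sum => y _; apply: ler_wpM2r => //.
rewrite -(sum_neighbours (uniq_box n) (w := w) (x := y)); last first.
  by move=> x xy; rewrite /conductance (negbTE xy).
by rewrite /weight [leRHS](bigID (mem (box n))) /= lerDl sumr_ge0.
Qed.

(** Unless the origin is isolated its weight is at least 1, so by stationarity
    the walk is at y with probability at most the weight of y, which is at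
    most 4 beta^(1 - b) when y is at distance at least b to the left. *)
Lemma step_iter_backward w N (b : nat) : (0 < b)%N ->
  step_iter w N (fun x => (x.1 <= - b%:Z)%R%:R) 0 <=
  4 * beta * (N.*2.+1 * N.*2.+1)%:R * beta ^- b.
Proof.
move=> b0; set g := fun x => _.
have g0 x : 0 <= g x by rewrite ler0n.
have B0 : 0 < beta by exact: lt_trans beta1.
have rhs0 : 0 <= 4 * beta * (N.*2.+1 * N.*2.+1)%:R * beta ^- b.
  by rewrite !mulr_ge0 // ?ltW // invr_gt0 exprn_gt0.
have c0 := conductance_ge0 w beta1.
have [/hasP[y yn /= xy]|nadj] := boolP (has (open_adj w 0) (neighbours 0)); last first.
  apply: le_trans rhs0; case: N => [|N] /=.
    by rewrite /g /=; have -> : (0 <= - b%:Z :> int) = false by lia.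
  rewrite big1_seq // => y /andP[_ yn].
  rewrite /transition (_ : open_adj w 0 y = false) ?mul0r //.
  by apply: contraNF nadj => xy; apply/hasP; exists y.
have w1 : 1 <= weight beta w 0 by have := weight_lb beta1 xy; rewrite expr0z.
have it0 x : 0 <= step_iter w N g x.
  by rewrite -(path_mean_last _ _ _ _ 0) path_mean_ge0.
apply: (@le_trans _ _ (weight beta w 0 * step_iter w N g 0)).
  by rewrite ler_peMl.
have -> : weight beta w 0 * step_iter w N g 0 =
   \sum_(x <- box 0) weight beta w x * step_iter w N g x.
  have -> : box 0 = [:: 0] by [].
  by rewrite big_seq1.
apply: (le_trans (step_iter_weight w N 0 g0)); rewrite add0n.
apply: (@le_trans _ _ (\sum_(x <- box N) 4 * beta * beta ^- b)); last first.
  rewrite big_const_seq count_predT size_box iter_addr_0.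
  by rewrite -[X in X <= _]mulr_natr mulrAC lexx.
apply: ler_sum => x _; rewrite /g; case: (boolP (x.1 <= - b%:Z)) => xb /=; last first.
  by rewrite mulr0 mulr_ge0 // ?mulr_ge0 // ?ltW // invr_gt0 exprn_gt0.
rewrite mulr1 /weight.
apply: (@le_trans _ _ (\sum_(y <- neighbours x) beta * beta ^- b)).
  rewrite big_seq [leRHS]big_seq; apply: ler_sum => z zn; rewrite /conductance.
  have bb : beta * beta ^- b = beta ^ (1 - b%:Z).
    by rewrite expfzDr ?gt_eqF // expr1z exprnN.
  case: ifP => _; last by rewrite bb exprz_ge0 // ltW.
  rewrite bb ler_weXz2l //; first exact: ltW.
  by case: x z xb zn => [x1 x2] [z1 z2]; rewrite /neighbours !inE !xpair_eqE /=; lia.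
rewrite -[4 * _ * _]mulrA /neighbours !big_cons big_nil.
by move: (beta * _) => c; lra.
Qed.

Fixpoint nn_paths (N : nat) (x : vertex) : seq (seq vertex) :=
  if N is N'.+1 then
    flatten [seq [seq x :: s | s <- nn_paths N' y] | y <- neighbours x]
  else [:: [:: x]].

Fixpoint path_prob (w : edge -> bool) (x : vertex) (s : seq vertex) : R :=
  if s is y :: s' then transition beta w x y * path_prob w y s' else 1.

Lemma path_meanE w N x E :
  path_mean w N x E = \sum_(s <- nn_paths N x) path_prob w x (behead s) * E s.
Proof.
elim: N x E => [|N IH] x E; first by rewrite /= big_seq1 /= mul1r.
have -> : nn_paths N.+1 x =
  flatten [seq [seq x :: s | s <- nn_paths N y] | y <- neighbours x] by [].
rewrite big_flatten big_map.
have -> : path_mean w N.+1 x E = \sum_(y <- neighbours x)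
  transition beta w x y * path_mean w N y (fun s => E (x :: s)) by [].
apply: eq_bigr => y _.
rewrite IH mulr_sumr big_map big_seq [RHS]big_seq; apply: eq_bigr => s sN.
suff [s' ->] : exists s', s = y :: s' by rewrite /= mulrA.
case: N sN {IH} => [|N]; first by rewrite inE => /eqP ->; exists [::].
by move=> /flattenP[_ /mapP[z _ ->] /mapP[s' _ ->]]; exists s'.
Qed.

Lemma path_prob_eq0 w x s : x :: s \notin nn_paths (size s) x ->
  path_prob w x s = 0.
Proof.
elim: s x => [|y s IH] x; first by rewrite /= inE eqxx.
move=> h; have [yx|yx] := boolP (y \in neighbours x); last first.
  rewrite /= /transition (_ : open_adj w x y = false) ?mul0r //.
  by apply: contraNF yx; exact: open_adj_neighbours.
rewrite /= IH ?mulr0 //; apply: contra h => h.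
apply/flattenP; exists [seq x :: s0 | s0 <- nn_paths (size s) y].
  by apply/mapP; exists y.
by apply/mapP; exists (y :: s).
Qed.

Lemma nn_paths_head N x s : s \in nn_paths N x -> head 0 s = x /\ size s = N.+1.
Proof.
elim: N x s => [|N IH] x s; first by rewrite inE => /eqP ->.
by move=> /flattenP[_ /mapP[z _ ->] /mapP[s' /IH[_ ss] ->]] /=; rewrite ss.
Qed.

Lemma quenched_probE w s : s != [::] ->
  quenched_prob beta w (size s).-1 (nth 0 s) =
  (head 0 s == 0)%:R * path_prob w (head 0 s) (behead s).
Proof.
case: s => // x s _; rewrite /quenched_prob /=; congr (_ * _).
elim: s x => [|y s IH] x; first by rewrite big_ord0.
by rewrite big_ord_recl /= -IH.
Qed.

End path_expectation.

(** * Measurability and independence in percolation *)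

Lemma measurable_open (e : edge) : measurable [set w : config | w e = true].
Proof. by apply: sub_gen_smallest; exists e. Qed.

Lemma measurable_determined (s : seq edge) (F : (edge -> bool) -> bool) :
  determined (fun e => e \in s) F -> measurable [set w : config | F w].
Proof.
elim: s F => [|e s IH] F dF.
  have [F0|F0] := boolP (F (fun=> false)).
    rewrite (_ : [set w | _] = setT) //; apply/seteqP; split => // w _ /=.
    by rewrite (dF w (fun=> false)).
  rewrite (_ : [set w | _] = set0) //; apply/seteqP; split => // w /=.
  by rewrite (dF w (fun=> false)) // (negbTE F0).
have dF' b : determined (fun e => e \in s) (fun w => F (upd w e b)).
  move=> w w' ww; apply: dF => e'; rewrite inE /upd.
  by case: eqP => //= _ /ww.
rewrite (_ : [set w | _] =
    ([set w : config | w e = true] `&` [set w : config | F (upd w e true)]) `|`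
    (~` [set w : config | w e = true] `&` [set w : config | F (upd w e false)])).
  apply: measurableU; apply: measurableI; try exact: IH.
    exact: measurable_open.
  exact: (measurableC (measurable_open e)).
have self w b : w e = b -> upd w e b = w.
  by move=> wb; apply/funext => e'; rewrite /upd; case: eqP => // ->.
apply/seteqP; split => w /=.
  by move=> Fw; case we : (w e); [left|right]; rewrite self.
by case=> -[we]; rewrite self //; apply/negbTE/negP.
Qed.

Lemma measurable_fun_determined (R : realType) (s : seq edge) (F : (edge -> bool) -> R) :
  determined (fun e => e \in s) F -> measurable_fun [set: config] F.
Proof.
move=> dF _ Y mY; rewrite setTI.
rewrite (_ : F @^-1` Y = [set w : config | `[< Y (F w) >]]).
  by apply: (measurable_determined (s := s)) => w w' /dF ->.
by apply/seteqP; split => w /=; rewrite asboolE.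
Qed.

Section percolation.
Context {R : realType}.
Variables (p : R) (Q : probability config R).
Hypothesis lawQ : percolation_law p Q.

(** The list t contains the edges whose state is already fixed, s those that
    remain to be averaged. *)
Let law_cond (t s : seq edge) (b : edge -> bool) (F : (edge -> bool) -> bool) :
  uniq (t ++ s) -> determined (fun e => e \in t ++ s) F ->
  Q [set w | {in t, forall e, w e = b e} /\ F w] =
  ((\prod_(e <- t) (if b e then p else 1 - p)) *
    avg p s (fun w => (F w)%:R) b)%:E.
Proof.
elim: s t b => [|e s IH] t b us dF.
  rewrite cats0 in us dF *; rewrite /=.
  have E w : {in t, forall e, w e = b e} -> F w = F b by move=> wb; exact: dF.
  case Fb : (F b).
    rewrite mulr1 -(lawQ _ us); congr (Q _); apply/seteqP.
    by split => w /= => [[]//|wb]; split => //; rewrite E.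
  rewrite mulr0 (_ : [set w | _] = set0) ?measure0 //.
  by apply/seteqP; split => w //= -[/E ->]; rewrite Fb.
have us' : uniq ((e :: t) ++ s).
  by rewrite (perm_uniq (_ : perm_eq _ (t ++ e :: s))) // perm_sym perm_catC /= perm_cons perm_catC.
have et : e \notin t by move: us'; rewrite /= mem_cat negb_or => /andP[/andP[]].
have dF' : determined (fun e' => e' \in (e :: t) ++ s) F.
  move=> w w' ww; apply: dF => e' he'; apply: ww; move: he'.
  by rewrite !(mem_cat, inE) /= orbCA orbA.
have split_e : [set w : config | {in t, forall e, w e = b e} /\ F w] =
   [set w : config | {in e :: t, forall e', w e' = upd b e true e'} /\ F w] `|`
   [set w : config | {in e :: t, forall e', w e' = upd b e false e'} /\ F w].
  have sub c w : {in e :: t, forall e', w e' = upd b e c e'} ->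
      {in t, forall e, w e = b e}.
    move=> h e' e't; rewrite h ?inE ?e't ?orbT // /upd; case: eqP => // ee.
    by rewrite -ee e't in et.
  apply/seteqP; split => w /=.
    move=> [wb Fw]; case we : (w e); [left|right]; split => // e';
    by rewrite inE /upd; case: eqP => [-> //|_ /= /wb].
  by case=> -[/sub].
have m c : measurable [set w : config | {in e :: t, forall e', w e' = upd b e c e'} /\ F w].
  rewrite (_ : [set w | _] = [set w : config |
     all (fun e' => w e' == upd b e c e') (e :: t) && F w]).
    apply: (measurable_determined (s := (e :: t) ++ s)) => w w' ww.
    rewrite (dF' _ _ ww); congr (_ && _); apply: eq_in_all => e' he'.
    by rewrite ww // mem_cat he'.
  apply/seteqP; rewrite /mkset; split => w.
    by move=> [h Fw]; apply/andP; split => //; apply/allP => e' /h ->.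
  by move=> /andP[/allP h ?]; split => // e' /h /eqP.
rewrite split_e measureU //; last first.
  apply/seteqP; split => w //= -[[h _] [h' _]].
  have := h e (mem_head _ _); rewrite (h' e (mem_head _ _)) /upd eqxx.
  by [].
have h1 := IH _ (upd b e true) us' dF'; have h2 := IH _ (upd b e false) us' dF'.
transitivity (((\prod_(e' <- e :: t) (if upd b e true e' then p else 1 - p)) *
    avg p s (fun w => (F w)%:R) (upd b e true))%:E +
  ((\prod_(e' <- e :: t) (if upd b e false e' then p else 1 - p)) *
    avg p s (fun w => (F w)%:R) (upd b e false))%:E)%E.
  by congr (_ + _)%E; [exact: h1|exact: h2].
rewrite -EFinD; congr EFin; rewrite !big_cons /upd !eqxx /=.
have E c : \prod_(j <- t) (if (if j == e then c else b j) then p else 1 - p) =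
    \prod_(e <- t) (if b e then p else 1 - p).
  rewrite big_seq [RHS]big_seq; apply: eq_bigr => e' e't; case: eqP => // ee.
  by rewrite -ee e't in et.
rewrite !E; ring.
Qed.

Lemma percolation_lawE (s : seq edge) (F : (edge -> bool) -> bool) w :
  uniq s -> determined (fun e => e \in s) F ->
  Q [set w | F w] = (avg p s (fun w => (F w)%:R) w)%:E.
Proof.
move=> us dF; have := @law_cond [::] s w F us dF; rewrite big_nil mul1r => <-.
by congr (Q _); apply/seteqP; split => w' //= -[].
Qed.

Lemma measurable_keep (K : pred edge) :
  measurable_fun [set: config] (keep K : config -> config).
Proof.
apply: (@measurability _ _ config config setT (keep K) coordinate_events) => //.
move=> _ [_ [e _ <-] <-]; rewrite setTI.
rewrite (_ : _ @^-1` _ = [set w : config | K e && w e]).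
  apply: (measurable_determined (s := [:: e])) => w w' ww.
  by rewrite ww // mem_head.
by apply/seteqP; split => w /=; rewrite /keep /=.
Qed.

Lemma keep_image (m : {measure set config -> \bar R}) (K : pred edge) :
  {m' : {measure set config -> \bar R} | forall A, m' A = m (keep K @^-1` A)}.
Proof.
unshelve eexists (pushforward m (keep K : config -> config)).
  exact: measurable_keep.
by [].
Qed.

(** For a fixed event F, two finite measures of the event A are compared. They
    agree on the cylinders of open edges, which are stable under intersection
    and generate the sigma-algebra; so A may depend on infinitely many edges,
    as the existence of an infinite cluster does. *)
Lemma percolation_indep (K : pred edge) (s : seq edge) (F : (edge -> bool) -> bool)
    (A : set config) : uniq s -> measurable A ->
  determined (fun e => (e \in s) && ~~ K e) F ->
  Q ((keep K @^-1` A) `&` [set w | F w]) =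
  ((avg p s (fun w => (F w)%:R) (fun=> false))%:E * Q (keep K @^-1` A))%E.
Proof.
move=> us mA dF; set q := avg _ _ _ _.
have dF1 : determined (fun e => e \in s) F.
  by apply: determined_sub dF _ => e /andP[].
have dF2 : determined (fun e => ~~ K e) F.
  by apply: determined_sub dF _ => e /andP[].
have mF : measurable [set w : config | F w] by exact: measurable_determined dF1.
have QF : Q [set w | F w] = q%:E by exact: percolation_lawE.
have q0 : 0 <= q by rewrite -lee_fin -QF.
pose cyl (t : seq edge) := [set w : config | all w t].
pose G := [set cyl t | t in setT].
have [m1 m1E] := keep_image (mrestr Q mF) K.
have [m2' m2E] := keep_image Q K.
pose m2 := mscale (NngNum q0) m2'.
suff : m1 A = m2 A by rewrite m1E /m2 /mscale /= m2E.
have mcyl t : measurable (cyl t).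
  apply: (measurable_determined (s := t) (F := fun w => all w t)) => w w' ww.
  by apply: eq_in_all => e /ww.
apply: (@measure_unique _ _ _ G (fun=> setT) _ _ _ _ m1 m2).
- rewrite /measurable /=; apply/seteqP; split.
    apply: smallest_sub; first exact: smallest_sigma_algebra.
    move=> _ [e _ <-]; apply: sub_gen_smallest; exists [:: e] => //.
    by apply/seteqP; rewrite /cyl /mkset; split => w /=; rewrite andbT.
  apply: smallest_sub; first exact: (@sigma_algebra_measurable _ config).
  by move=> _ [t _ <-]; exact: mcyl.
- move=> _ _ [t _ <-] [t' _ <-]; exists (t ++ t') => //.
  by apply/seteqP; rewrite /cyl /mkset; split => w; rewrite /= all_cat => /andP.
- by move=> _; exists [::] => //; apply/seteqP; split.
- by rewrite bigcup_const //; exists 0%N.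
- move=> _ [t _ <-]; rewrite m1E /mrestr.
  transitivity (q%:E * m2' (cyl t))%E; last by [].
  rewrite m2E.
  pose H w := all (keep K w) t.
  have dH : determined (fun e => (e \in t) && K e) H.
    move=> w w' ww; apply: eq_in_all => e et; rewrite /keep.
    by case Ke : (K e) => //=; rewrite ww // et.
  transitivity (Q [set w : config | H w && F w]).
    by congr (Q _); apply/seteqP; rewrite /cyl /H /mkset; split => w /andP.
  transitivity (q%:E * Q [set w : config | H w])%E; last by [].
  pose u := undup (t ++ s).
  have uu : uniq u by exact: undup_uniq.
  have dHu : determined (fun e => e \in u) H.
    by apply: determined_sub dH _ => e /andP[et _]; rewrite mem_undup mem_cat et.
  have dFu : determined (fun e => e \in u) F.
    by apply: determined_sub dF1 _ => e es; rewrite mem_undup mem_cat es orbT.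
  rewrite (percolation_lawE (fun=> false) uu dHu).
  rewrite (percolation_lawE (s := u) (fun=> false)) //; last first.
    by move=> w w' ww; rewrite (dHu _ _ ww) (dFu _ _ ww).
  rewrite -EFinM; congr EFin.
  rewrite (eq_avg _ _ (G := fun w => (H w)%:R * (F w)%:R)); last first.
    by move=> w /=; rewrite -natrM mulnb.
  pose toR (c : bool) : R := c%:R.
  rewrite (avg_indep _ _ _ (determined_comp toR dH) (determined_comp toR dF2)); last first.
    by move=> e /andP[_ ->].
  rewrite mulrC; congr (_ * _).
  apply: (avg_eq _ _ _ (determined_comp toR dF)) => // e /andP[es _] //.
  by rewrite mem_undup mem_cat es orbT.
- move=> k; rewrite m1E /mrestr (le_lt_trans (probability_le1 Q _)) // ?ltry //.
  by rewrite preimage_setT setTI.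
- exact: mA.
Qed.

End percolation.

(** * The conditioned environment *)

Lemma measurable_countable_union d (T : measurableType d) (I : countType)
    (F : I -> set T) : (forall i, measurable (F i)) ->
  measurable [set t | exists i, F i t].
Proof.
move=> mF; rewrite (_ : [set t | _] = \bigcup_i F i).
  by apply: countable_bigcupT_measurable => //; exact: countableP.
by apply/seteqP; split => t /= [i] => [Fit|_ Fit]; exists i.
Qed.

Lemma measurable_countable_inter d (T : measurableType d) (I : countType)
    (F : I -> set T) : (forall i, measurable (F i)) ->
  measurable [set t | forall i, F i t].
Proof.
move=> mF; rewrite (_ : [set t | _] = ~` [set t | exists i, (~` F i) t]).
  by apply/measurableC/measurable_countable_union => i; exact: measurableC.
apply/seteqP; split => t /=; first by move=> h [i]; apply.
by move=> h i; apply: contrapT => nF; apply: h; exists i.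
Qed.

Lemma open_adj_determined x y :
  determined (fun e => (e.1 == x) || (e.1 == y)) (fun w => open_adj w x y).
Proof.
move=> w w' ww; rewrite /open_adj !ww //= ?eqxx ?orbT //.
Qed.

Lemma measurable_open_adj x y : measurable [set w : config | open_adj w x y].
Proof.
apply: (measurable_determined (F := fun w => open_adj w x y)
  (s := [seq (v, t) | v <- [:: x; y], t <- [:: true; false]])).
apply: determined_sub (@open_adj_determined x y) _ => -[v t] h.
by apply/allpairsP; exists (v, t); split; rewrite ?inE //; case: (t).
Qed.

Lemma infinite_vertices (A : set vertex) :
  infinite_set A <-> forall s : seq vertex, exists y, y \notin s /\ A y.
Proof.
split=> [iA s|h].
  apply: contrapT => nex; apply: iA; apply: (sub_finite_set (B := [set` s])).
    move=> y Ay /=; apply: contrapT => ys; apply: nex; exists y; split => //.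
    exact/negP.
  exact: finite_seq.
move=> /finite_seqP[s As]; have [y [ys]] := h s.
by rewrite As /= (negbTE ys).
Qed.

Local Notation left_adj w := [rel u v | [&& left_half_plane u, left_half_plane v
                       & open_adj w u v]].

Lemma measurable_origin_event : measurable origin_in_infinite_left_cluster.
Proof.
have mpath (s : seq vertex) (x : vertex) : measurable [set w : config | path (left_adj w) x s].
  elim: s x => [|y s IH] x.
    by rewrite (_ : [set w | _] = setT) //; apply/seteqP; split.
  rewrite (_ : [set w | _] = [set w : config | (left_half_plane x && left_half_plane y) /\ open_adj w x y]
      `&` [set w : config | path (left_adj w) y s]).
    apply: measurableI => //; case: (left_half_plane x && left_half_plane y).
      rewrite (_ : [set w | _] = [set w : config | open_adj w x y]).
        exact: measurable_open_adj.
      by apply/seteqP; split => w /= => [[]//|].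
    by rewrite (_ : [set w | _] = set0) //; apply/seteqP; split => w // [].
  apply/seteqP; split => w /=.
    by move=> /andP[/and3P[-> -> ->] ->].
  by move=> [[/andP[-> ->] ->] ->].
have mcl (y : vertex) : measurable [set w : config | left_cluster w 0 y].
  rewrite (_ : [set w | _] = [set w : config | exists s, (path (left_adj w) 0 s /\ last 0 s = y)]).
    apply: measurable_countable_union => s.
    have [E|E] := eqVneq (last 0 s) y.
      rewrite (_ : (fun _ => _) = [set w : config | path (left_adj w) 0 s]) //.
      by apply/seteqP; split => w /= => [[]//|].
    rewrite (_ : (fun _ => _) = set0) //; apply/seteqP; split => w // [_ /eqP].
    by rewrite (negbTE E).
  apply/seteqP; split => w /=; first by move=> [s ps ls]; exists s.
  by move=> [s [ps ls]]; exists s.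
rewrite /origin_in_infinite_left_cluster.
rewrite (_ : [set w | _] = [set w : config | forall s : seq vertex,
   exists y : vertex, y \notin s /\ left_cluster w 0 y]).
  apply: measurable_countable_inter => s; apply: measurable_countable_union => y.
  case: (y \notin s).
    rewrite (_ : (fun _ => _) = [set w : config | left_cluster w 0 y]) //.
    by apply/seteqP; split => w /= => [[]//|].
  by rewrite (_ : (fun _ => _) = set0) //; apply/seteqP; split => w // [].
by apply/seteqP; split => w /infinite_vertices.
Qed.

(** Edges that the walk may have met when it first reaches column a. The
    vertical edges of column a are included so that, for a >= 0, these edges
    determine the conditioning event in the left half-plane. *)
Definition past (a : int) : pred edge := fun e =>
  if e.2 then e.1.1 <= a else e.1.1 < a.

Lemma origin_event_past (a : int) w : 0 <= a ->
  origin_in_infinite_left_cluster (keep (past a) w) <->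
  origin_in_infinite_left_cluster w.
Proof.
move=> a0; rewrite /origin_in_infinite_left_cluster /=.
suff -> : left_cluster (keep (past a) w) 0 = left_cluster w 0 by [].
have E : left_adj (keep (past a) w) =2 left_adj w.
  move=> u v /=; case: (boolP (left_half_plane u)) => //= lu.
  case: (boolP (left_half_plane v)) => //= lv.
  apply/open_adjP/open_adjP; move: lu lv; rewrite /left_half_plane /keep /past.
    by move=> lu lv; case=> -[? /andP[_ ?]]; [apply: Or41|apply: Or42|apply: Or43|apply: Or44].
  move=> lu lv; case=> -[E ->]; [apply: Or41|apply: Or42|apply: Or43|apply: Or44];
    (split => //; rewrite andbT /=; move: lu lv; rewrite E /=; lia).
by apply/seteqP; split => y [s ps ls]; exists s => //; move: ps; rewrite (eq_path E).
Qed.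

Lemma open_adj_past (a : int) w x y : x.1 < a ->
  open_adj (keep (past a) w) x y = open_adj w x y.
Proof.
move=> xa; apply/open_adjP/open_adjP; rewrite /keep /past.
  by case=> -[? /andP[_ ?]]; [apply: Or41|apply: Or42|apply: Or43|apply: Or44].
case=> -[E ->]; [apply: Or41|apply: Or42|apply: Or43|apply: Or44];
  (split => //; rewrite andbT /=; move: xa; rewrite ?E /=; lia).
Qed.

Lemma transition_past (R : realType) (beta : R) (a : int) w x y : x.1 < a ->
  transition beta (keep (past a) w) x y = transition beta w x y.
Proof.
move=> xa; rewrite /transition /open_degree !(open_adj_past _ _ xa).
by rewrite (eq_count (fun y => open_adj_past w y xa)).
Qed.

Lemma transition_determined (R : realType) (beta : R) x y :
  determined (fun e => e \in [seq (v, t) | v <- x :: y :: neighbours x, t <- [:: true; false]])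
    (fun w => transition beta w x y).
Proof.
move=> w w' ww.
have E z : z \in x + e1 :: y :: neighbours x -> open_adj w x z = open_adj w' x z.
  move=> hz; apply: open_adj_determined => -[v t] h; apply: ww.
  apply/allpairsP; exists (v, t); split; [|by case: (t)|by []].
  move: hz h; rewrite /neighbours !inE /= => hz /orP[/eqP->|/eqP ->]; first by rewrite eqxx.
  by move: hz; case: (z == x + e1); rewrite ?orbT //= => ->; rewrite orbT.
rewrite /transition /open_degree !E ?mem_head ?inE ?eqxx ?orbT //.
rewrite (@eq_in_count _ (open_adj w x) (open_adj w' x)) // => z zn.
by apply: E; rewrite in_cons in_cons zn !orbT.
Qed.

Lemma measurable_transition (R : realType) (beta : R) x y :
  measurable_fun [set: config] (fun w => transition beta w x y).
Proof. exact: (measurable_fun_determined (@transition_determined R beta x y)). Qed.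

Lemma measurable_hit (R : realType) (beta theta : R) (a : int)
    (phi : config -> vertex -> R) N x :
  (forall y, measurable_fun [set: config] (fun w => phi w y)) ->
  measurable_fun [set: config] (fun w => hit beta w theta a (phi w) N x).
Proof.
move=> mphi; elim: N x => [|N IH] x /=; (case: (a <= x.1); first exact: mphi).
  exact: measurable_cst.
apply: measurable_funM; first exact: measurable_cst.
apply: measurable_sum => y; apply: measurable_funM => //.
exact: measurable_transition.
Qed.

Lemma integral_mrestrE d (T : measurableType d) (R : realType)
    (mu : {measure set T -> \bar R}) (D : set T) (mD : measurable D)
    (f : T -> \bar R) : measurable_fun setT f -> (forall t, 0 <= f t)%E ->
  (\int[mrestr mu mD]_t f t = \int[mu]_(t in D) f t)%E.
Proof.
move=> mf f0; rewrite -(setUv D) ge0_integral_setU //=; first last.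
- by rewrite /disj_set setICr.
- by rewrite setUv.
- exact: measurableC.
rewrite (eq_measure_integral mu); last first.
  by move=> A mA AD; rewrite /= /mrestr setIidl.
rewrite (eq_measure_integral mzero (D := ~` D)); last first.
  move=> A mA AD; rewrite /= /mrestr (_ : A `&` D = set0) ?measure0 //.
  by apply/seteqP; split => t // [/AD].
by rewrite integral_measure_zero adde0.
Qed.

Lemma hit_cst1_le1 (R : realType) (beta theta : R) w (a : int) N x :
  1 < beta -> 0 <= theta <= 1 -> hit beta w theta a (fun=> 1) N x <= 1.
Proof.
move=> b1 /andP[t0 t1]; apply: (@hit_le R beta w b1 theta a (fun=> 1) (fun=> 1) N x) => // y ya.
rewrite mulr_ile1 //.
  by apply: sumr_ge0 => z _; rewrite mulr1 transition_ge0.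
under eq_bigr do rewrite mulr1.
exact: sum_transition_le1.
Qed.

Lemma hit_sub (R : realType) (beta theta : R) w (a : int) phi psi (eta : R) N x :
  hit beta w theta a (fun y => phi y - eta * psi y) N x =
  hit beta w theta a phi N x - eta * hit beta w theta a psi N x.
Proof.
elim: N x => [|N IH] x /=; case: ifP => // _; first by rewrite mulr0 subrr.
set S1 := \sum_(y <- _) _ * hit _ _ _ _ phi _ _; set S2 := \sum_(y <- _) _ * hit _ _ _ _ psi _ _.
have -> : theta * S1 - eta * (theta * S2) = theta * (S1 - eta * S2) by ring.
congr (_ * _); rewrite /S1 /S2 mulr_sumr -sumrB.
by apply: eq_bigr => y _; rewrite IH; ring.
Qed.

(** Before reaching column b the walk reaches column a, and phi bounds the
    discount that remains from there. *)
Lemma hit_nested (R : realType) (beta theta : R) w (a b : int)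
    (phi : vertex -> R) N x : 1 < beta -> 0 <= theta -> a <= b ->
  (forall y n, a <= y.1 -> hit beta w theta b (fun=> 1) n y <= phi y) ->
  hit beta w theta b (fun=> 1) N x <= hit beta w theta a phi N x.
Proof.
move=> b1 t0 ab h; elim: N x => [|N IH] x.
  rewrite [leRHS]/=; case: ifP => xa; first exact: (h x 0%N).
  by rewrite /=; case: ifP => //; lia.
rewrite [leRHS]/=; case: ifP => xa; first exact: (h x N.+1).
rewrite /=; case: ifP => xb; first lia.
apply: ler_wpM2l => //; apply: ler_sum => y _; apply: ler_wpM2l => //.
exact: transition_ge0.
Qed.

Section annealed.
Context {R : realType}.
Variables (p beta : R) (d : measure_display) (T : measurableType d).
Variables (P : probability T R) (om : T -> config) (Z : nat -> T -> vertex).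
Hypotheses (beta1 : 1 < beta) (walk : annealed_walk p beta P om Z).

Let mom : measurable_fun setT om. Proof. exact: annealed_measurable_env walk. Qed.

(** The conditioning event depends on past edges only, so it does not affect
    the law of the other edges nor their independence of the past. *)
Lemma environment_indep (a : int) (s : seq edge) (F : (edge -> bool) -> bool)
    (A : set config) : 0 <= a -> uniq s -> measurable A ->
  determined (fun e => (e \in s) && ~~ past a e) F ->
  (P (om @^-1` ((keep (past a) @^-1` A) `&` [set w | F w])) =
  (avg p s (fun w => (F w)%:R) (fun=> false))%:E * P (om @^-1` (keep (past a) @^-1` A)))%E.
Proof.
move=> a0 us mA dF; have [Q lawQ envQ] := annealed_env_law walk.
have mO := measurable_origin_event.
have mF : measurable [set w : config | F w].
  by apply: (measurable_determined (s := s)); apply: determined_sub dF _ => e /andP[].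
have mK : measurable (keep (past a) @^-1` A : set config).
  by rewrite -[X in measurable X]setTI; exact: measurable_keep.
rewrite !envQ //; last exact: measurableI.
have -> : keep (past a) @^-1` A `&` [set w | F w] `&` origin_in_infinite_left_cluster =
    (keep (past a) @^-1` (A `&` origin_in_infinite_left_cluster)) `&` [set w : config | F w].
  apply/seteqP; split => w /=.
    by move=> [[Aw Fw] /(origin_event_past w a0)].
  by move=> [[Aw /(origin_event_past w a0)]].
rewrite (percolation_indep lawQ us _ dF); last exact: measurableI.
rewrite muleA; congr (_ * Q _ * _)%E.
apply/seteqP; split => w /=; by move=> [Aw /(origin_event_past w a0)].
Qed.

Lemma integral_indep (a : int) (s : seq edge) (F : (edge -> bool) -> bool)
    (g : config -> R) : 0 <= a -> uniq s ->
  determined (fun e => (e \in s) && ~~ past a e) F ->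
  measurable_fun setT g -> (forall w, 0 <= g w) ->
  (forall w, g (keep (past a) w) = g w) ->
  (\int[P]_t (g (om t) * (F (om t))%:R)%:E =
   (avg p s (fun w => (F w)%:R) (fun=> false))%:E * \int[P]_t (g (om t))%:E)%E.
Proof.
move=> a0 us dF mg g0 gk; set q := avg _ _ _ _.
have mF : measurable [set w : config | F w].
  by apply: (measurable_determined (s := s)); apply: determined_sub dF _ => e /andP[].
pose D : set T := om @^-1` [set w : config | F w].
have mD : measurable D by rewrite -[X in measurable X]setTI; exact: mom.
have q0 : 0 <= q.
  have := environment_indep a0 us measurableT dF.
  rewrite !preimage_setT probability_setT mule1 -lee_fin => <-.
  exact: measure_ge0.
pose phi : T -> config := keep (past a) \o om.
have mphi : measurable_fun setT phi.
  by apply: measurableT_comp => //; exact: measurable_keep.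
have mgE : measurable_fun setT (fun w : config => (g w)%:E) by exact/measurable_EFinP.
transitivity (\int[P]_(t in D) (g (om t))%:E)%E.
  rewrite [RHS]integral_mkcond; apply: eq_integral => t _.
  rewrite /patch; case: ifPn => tD.
    by move: tD; rewrite inE /D /= => ->; rewrite mulr1.
  case Ft : (F (om t)); last by rewrite mulr0.
  by move: tD; rewrite notin_setE /D /= Ft.
transitivity (\int[P]_(t in D) (g (phi t))%:E)%E.
  by apply: eq_integral => t _; rewrite /phi /= gk.
have [m1 m1E] : {m' : {measure set config -> \bar R} | forall A, m' A = mrestr P mD (phi @^-1` A)}.
  by unshelve eexists (pushforward (mrestr P mD) phi).
have [m2 m2E] : {m' : {measure set config -> \bar R} | forall A, m' A = P (phi @^-1` A)}.
  by unshelve eexists (pushforward P phi).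
have E1 : (\int[P]_(t in D) (g (phi t))%:E = \int[m1]_w (g w)%:E)%E.
  rewrite -integral_mrestrE; last 2 first.
  - by apply/measurable_EFinP; apply: measurableT_comp.
  - by move=> t; rewrite lee_fin.
  rewrite (eq_measure_integral (pushforward (mrestr P mD) phi) (m1 := m1)) //.
  rewrite ge0_integral_pushforward ?preimage_setT //.
  by move=> w _; rewrite lee_fin.
have E2 : (\int[P]_t (g (om t))%:E = \int[m2]_w (g w)%:E)%E.
  transitivity (\int[P]_t (g (phi t))%:E)%E.
    by apply: eq_integral => t _; rewrite /phi /= gk.
  rewrite (eq_measure_integral (pushforward P phi) (m1 := m2)) //.
  rewrite ge0_integral_pushforward ?preimage_setT //.
  by move=> w _; rewrite lee_fin.
rewrite E1 E2 -[q]/((NngNum q0)%:num) -ge0_integral_mscale //; last first.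
  by move=> w _; rewrite lee_fin.
apply: eq_measure_integral => A mA _; rewrite m1E /= /mscale /= m2E.
by have := environment_indep a0 us mA dF; rewrite -/q /mrestr /phi /D => <-.
Qed.

End annealed.

(** * Renewal at fresh columns *)

Lemma negligible_countable_union d (T : measurableType d) (R : realType)
    (mu : {measure set T -> \bar R}) (I : countType) (F : I -> set T) :
  (forall i, mu.-negligible (F i)) -> mu.-negligible [set t | exists i, F i t].
Proof.
move=> nF; rewrite (_ : [set t | _] =
    \bigcup_n (if unpickle n is Some i then F i else set0)).
  by apply: negligible_bigcup => n; case: (unpickle n) => [i //|]; exact: negligible_set0.
apply/seteqP; split => t.
  by move=> [i Fit]; exists (pickle i) => //; rewrite pickleK.
by move=> [n _]; case: (unpickle n) => // i Fit; exists i.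
Qed.

Section renewal.
Context {R : realType}.
Variables (p beta : R) (d : measure_display) (T : measurableType d).
Variables (P : probability T R) (om : T -> config) (Z : nat -> T -> vertex).
Hypotheses (beta1 : 1 < beta) (walk : annealed_walk p beta P om Z).
Variables (s : seq edge) (F : (edge -> bool) -> bool).
Hypotheses (us : uniq s) (dF : determined (fun e => (e \in s) && fresh e) F).
Variable (theta : R).
Hypothesis theta01 : 0 <= theta <= 1.

Let mom : measurable_fun setT om. Proof. exact: annealed_measurable_env walk. Qed.
Let q : R := avg p s (fun w => (F w)%:R) (fun=> false).
Let theta0 : 0 <= theta. Proof. by case/andP: theta01. Qed.

(** Indicator that the walk which enters column a at y has the event F ahead
    of it. *)
Definition entering (a : int) (w : edge -> bool) (y : vertex) : R :=
  if y.1 == a then (F (fun e => w (translate y e)))%:R else 0.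

Let translated_F (x : vertex) : uniq [seq translate x e | e <- s] /\
  determined (fun e => (e \in [seq translate x e | e <- s]) && ~~ past x.1 e)
    (fun w => F (fun e => w (translate x e))).
Proof.
split; first by rewrite map_inj_uniq //; exact: can_inj (@translateK x).
apply: (determined_relabel false dF) => -[v t] /andP[vs fv].
rewrite map_f //= /past /translate /=; move: fv; rewrite /fresh /=.
by case: t vs => _; lia.
Qed.

Let measurable_entering (a : int) y : measurable_fun [set: config] (fun w => entering a w y).
Proof.
rewrite /entering; case: (y.1 == a); last exact: measurable_cst.
apply: (measurable_fun_determined (s := [seq translate y e | e <- s])).
have [_ dy] := translated_F y.
apply: (determined_comp (fun c : bool => c%:R : R)).
by apply: determined_sub dy _ => e /andP[].
Qed.

Lemma entering_ge0 a w y : 0 <= entering a w y.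
Proof. by rewrite /entering; case: ifP => _ //; rewrite ler0n. Qed.

Let mint (f : config -> R) : measurable_fun [set: config] f ->
  measurable_fun setT (fun t => (f (om t))%:E).
Proof. by move=> mf; apply/measurable_EFinP; apply: measurableT_comp. Qed.

Let mcomp (f : config -> R) : measurable_fun [set: config] f ->
  measurable_fun setT (fun t => f (om t)).
Proof. by move=> mf; apply: measurableT_comp. Qed.

(** When the walk first reaches column a, the edges ahead are independent of
    its past, so F has there its unconditioned probability q. In the
    induction, g collects the transitions already made, which are functions of
    past edges. *)
Lemma hit_anneal (a : int) (g : config -> R) N (x : vertex) : 0 <= a -> x.1 <= a ->
  measurable_fun setT g -> (forall w, 0 <= g w) ->
  (forall w, g (keep (past a) w) = g w) ->
  (\int[P]_t (g (om t) * hit beta (om t) theta a (entering a (om t)) N x)%:E =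
   q%:E * \int[P]_t (g (om t) * hit beta (om t) theta a (fun=> 1%R) N x)%:E)%E.
Proof.
move=> a0.
have on_column n y (f : config -> R) : y.1 = a -> measurable_fun setT f ->
    (forall w, 0 <= f w) -> (forall w, f (keep (past a) w) = f w) ->
    (\int[P]_t (f (om t) * hit beta (om t) theta a (entering a (om t)) n y)%:E =
     q%:E * \int[P]_t (f (om t) * hit beta (om t) theta a (fun=> 1%R) n y)%:E)%E.
  move=> yE mf f0 fk.
  have hitE w phi : hit beta w theta a phi n y = phi y.
    by case: n => [|n] /=; rewrite yE lexx.
  under eq_integral do rewrite hitE /entering yE eqxx.
  under [in RHS]eq_integral do rewrite hitE mulr1.
  have [uy dy] := translated_F y; rewrite yE in dy.
  rewrite (integral_indep walk a0 uy dy) //; congr (_%:E * _)%E.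
  rewrite (avg_relabel_id p s (fun w => (F w)%:R) (fun=> false)) //.
  exact: can_inj (@translateK y).
elim: N x g => [|N IH] x g xa mg g0 gk;
  (have [ax|ax] := boolP (a <= x.1); first by apply: on_column => //; lia).
- under eq_integral do rewrite /= (negbTE ax) mulr0.
  under [in RHS]eq_integral do rewrite /= (negbTE ax) mulr0.
  by rewrite integral0 mule0.
- have xlt : x.1 < a by lia.
  pose G y w := g w * (theta * transition beta w x y).
  have expand (phi : config -> vertex -> R) :
      (forall y, measurable_fun [set: config] (fun w => phi w y)) ->
      (forall w y, 0 <= phi w y) ->
      (\int[P]_t (g (om t) * hit beta (om t) theta a (phi (om t)) N.+1 x)%:E =
       \sum_(y <- neighbours x)
         \int[P]_t (G y (om t) * hit beta (om t) theta a (phi (om t)) N y)%:E)%E.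
    move=> mphi phi0; rewrite -ge0_integral_sum //.
    + apply: eq_integral => t _; rewrite sumEFin; congr EFin.
      rewrite /= (negbTE ax) !mulr_sumr; apply: eq_bigr => y _.
      by rewrite /G; ring.
    + move=> y; apply: (mint (f := fun w => G y w * hit beta w theta a (phi w) N y)).
      apply: measurable_funM; last exact: measurable_hit.
      apply: measurable_funM => //; apply: measurable_funM => //.
      exact: measurable_transition.
    + move=> y t _; rewrite lee_fin mulr_ge0 ?hit_ge0 //.
      by rewrite /G !mulr_ge0 // transition_ge0.
  rewrite expand //; last exact: entering_ge0.
  rewrite (expand (fun _ _ => 1)) //.
  rewrite ge0_sume_distrr; last first.
    move=> y _; apply: integral_ge0 => t _; rewrite lee_fin mulr_ge0 ?hit_ge0 //.
    by rewrite /G !mulr_ge0 // transition_ge0.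
  rewrite big_seq [RHS]big_seq; apply: eq_bigr => y yn; apply: IH.
  + by move: yn; rewrite /neighbours !inE; case: (x) xlt => x1 x2 /=;
      case: y => y1 y2 /= ?; rewrite !xpair_eqE /=; lia.
  + apply: measurable_funM => //; apply: measurable_funM => //.
    exact: measurable_transition.
  + by move=> w; rewrite /G !mulr_ge0 // transition_ge0.
  + by move=> w; rewrite /G gk transition_past.
Qed.

Variables (L : int) (eta : R).
Hypotheses (L0 : 0 <= L) (eta0 : 0 <= eta).
Hypothesis slow : forall w, F w -> forall (a : int) N, L <= a ->
  hit beta w theta a (fun=> 1) N (0, 0) <= 1 - eta.

Let I (k N : nat) : \bar R :=
  (\int[P]_t (hit beta (om t) theta (L *+ k) (fun=> 1%R) N 0)%:E)%E.

(** A walk that meets F on reaching column L * k loses at least eta of its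
    discount before it reaches column L * (k + 1). *)
Lemma renewal_step k N :
  (I k.+1 N + (eta * q)%:E * I k N <= I k N)%E.
Proof.
pose a := L *+ k; have a0 : 0 <= a by rewrite mulrn_wge0.
have H0 w b phi n y : (forall y, 0 <= phi y) -> 0 <= hit beta w theta b phi n y.
  by move=> h; apply: hit_ge0.
have := @hit_anneal a (fun=> 1) N 0 a0 a0 (measurable_cst _) (fun _ => ler01) (fun=> erefl).
under eq_integral do rewrite mul1r.
under [in RHS]eq_integral do rewrite mul1r.
move=> hq.
rewrite EFinM -muleA /I -/a -hq -ge0_integralZl_EFin //; last 2 first.
- by move=> t _; rewrite lee_fin H0 // => y; exact: entering_ge0.
- by apply: (mint (f := fun w => hit beta w theta a (entering a w) N 0)); exact: measurable_hit.
rewrite -ge0_integralD //; first last.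
- apply/measurable_EFinP/measurable_funM => //.
  apply: (mcomp (f := fun w => hit beta w theta a (entering a w) N 0)).
  exact: measurable_hit.
- by move=> t _; rewrite lee_fin mulr_ge0 // H0 // => y; exact: entering_ge0.
- by apply: (mint (f := fun w => hit beta w theta (L *+ k.+1) (fun=> 1) N 0)); exact: measurable_hit.
- by move=> t _; rewrite lee_fin H0.
apply: ge0_le_integral => //.
- by move=> t _; rewrite lee_fin addr_ge0 ?mulr_ge0 ?H0 // => y; exact: entering_ge0.
- apply/measurable_EFinP; apply: measurable_funD.
    apply: (mcomp (f := fun w => hit beta w theta (L *+ k.+1) (fun=> 1) N 0)).
    exact: measurable_hit.
  apply: measurable_funM => //.
  apply: (mcomp (f := fun w => hit beta w theta a (entering a w) N 0)).
  exact: measurable_hit.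
- by apply: (mint (f := fun w => hit beta w theta a (fun=> 1) N 0)); exact: measurable_hit.
move=> t _; rewrite lee_fin -lerBrDr -hit_sub.
apply: hit_nested => //; first by rewrite mulrSr lerDl.
move=> y n ya; rewrite /entering; case: eqP => [yE|_]; last first.
  by rewrite mulr0 subr0 hit_cst1_le1.
case Fy : (F _); last by rewrite mulr0 subr0 hit_cst1_le1.
rewrite mulr1 -[y]add0r hit_translate yE mulrSr addrAC subrr add0r.
exact: slow.
Qed.

Hypotheses (p01 : 0 <= p <= 1) (eta1 : eta <= 1).

Lemma renewal_bound k N : (I k N <= ((1 - eta * q) ^+ k)%:E)%E.
Proof.
have q0 : 0 <= q by apply: avg_ge0 => // w; rewrite ler0n.
have q1 : q <= 1 by apply: avg_le1 => // w; rewrite lern1 leq_b1.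
have c1 : eta * q <= 1 by rewrite mulr_ile1.
have I1 j : (I j N <= 1)%E.
  rewrite /I -[leRHS](@probability_setT _ _ _ P) -[P setT]mul1e -integral_cst //.
  apply: ge0_le_integral => //.
  - by move=> t _; rewrite lee_fin hit_ge0.
  - apply: (mint (f := fun w => hit beta w theta (L *+ j) (fun=> 1) N 0)).
    exact: measurable_hit.
  - by move=> t _; rewrite lee_fin hit_cst1_le1.
have I0 j : (0 <= I j N)%E.
  by apply: integral_ge0 => t _; rewrite lee_fin hit_ge0.
have If j : I j N = (fine (I j N))%:E.
  by rewrite fineK // ge0_fin_numE // (le_lt_trans (I1 j)) // ltry.
elim: k => [|k IH]; first by rewrite expr0.
have := renewal_step k N; move: IH; rewrite (If k) (If k.+1).
move: (fine _) (fine _) => u v; rewrite -EFinM -EFinD !lee_fin exprS => IH h.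
apply: (@le_trans _ _ ((1 - eta * q) * v)); first by lra.
by apply: ler_wpM2l => //; rewrite subr_ge0.
Qed.

End renewal.

(** * Law of the trajectory *)

Section trajectories.
Context {R : realType}.
Variables (p beta : R) (d : measure_display) (T : measurableType d).
Variables (P : probability T R) (om : T -> config) (Z : nat -> T -> vertex).
Hypotheses (beta1 : 1 < beta) (walk : annealed_walk p beta P om Z).

Let mom : measurable_fun setT om. Proof. exact: annealed_measurable_env walk. Qed.

Definition trajectory (N : nat) (t : T) : seq vertex := mkseq (Z^~ t) N.+1.

Lemma trajectoryE N (s : seq vertex) : size s = N.+1 ->
  [set t | trajectory N t = s] =
  [set t | forall k, (k <= N)%N -> Z k t = nth 0 s k].
Proof.
move=> ss; apply/seteqP; split => t /=.
  by move=> <- k kN; rewrite nth_mkseq.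
move=> h; apply: (@eq_from_nth _ 0); rewrite size_mkseq ?ss // => k kN.
by rewrite nth_mkseq // h.
Qed.

Lemma measurable_trajectory N s : measurable [set t | trajectory N t = s].
Proof.
have [ss|ss] := eqVneq (size s) N.+1; last first.
  rewrite (_ : [set t | _] = set0) //; apply/seteqP; split => t //= ts.
  by move: ss; rewrite -ts size_mkseq eqxx.
rewrite trajectoryE // (_ : [set t | _] =
  [set t | forall k : nat, ((N < k)%N \/ Z k t = nth 0 s k)]).
  apply: measurable_countable_inter => k; case: (ltnP N k) => kN.
    by rewrite (_ : (fun _ => _) = setT) //; apply/seteqP; split => t // _; left.
  rewrite (_ : (fun _ => _) = [set t | Z k t = nth 0 s k]).
    exact: annealed_measurable_walk walk _ _.
  by apply/seteqP; split => t /= => [[]//|]; right.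
apply/seteqP; split => t /= h k.
  by case: (ltnP N k) => [|/h]; [left|right].
by move=> kN; case: (h k) => //; rewrite ltnNge kN.
Qed.

Lemma trajectory_law N s : size s = N.+1 ->
  P [set t | trajectory N t = s] =
  (\int[P]_t (quenched_prob beta (om t) N (nth 0%R s))%:E)%E.
Proof.
move=> ss; rewrite trajectoryE //.
have := annealed_walk_law walk N (nth 0 s) (@measurableT _ config).
by rewrite preimage_setT setTI.
Qed.

(** Nearest-neighbour trajectories from the origin are finitely many; the
    others form a countable union of null events. *)
Lemma trajectory_event (N : nat) (E : pred (seq vertex)) :
  measurable [set t | E (trajectory N t)] /\
  (P [set t | E (trajectory N t)] <=
   \int[P]_t (path_mean beta (om t) N 0%R (fun s => (E s)%:R))%:E)%E.
Proof.
pose good s := [set t | trajectory N t = s] : set T.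
pose bad := [set t | exists s : seq vertex,
   (s \notin nn_paths N 0) /\ trajectory N t = s] : set T.
have mbad1 (s : seq vertex) : measurable [set t | (s \notin nn_paths N 0) /\ trajectory N t = s].
  case: (s \notin _).
    rewrite (_ : [set t | _] = good s); first exact: measurable_trajectory.
    by apply/seteqP; split => t /= => [[]//|].
  by rewrite (_ : [set t | _] = set0) //; apply/seteqP; split => t // [].
have mbad : measurable bad by exact: measurable_countable_union.
have bad0 : P bad = 0%E.
  apply: measure_negligible => //.
  apply: negligible_countable_union => s.
  exists [set t | (s \notin nn_paths N 0) /\ trajectory N t = s]; split => //.
  have [sN|sN] := boolP (s \in nn_paths N 0).
    rewrite (_ : [set t | _] = set0) ?measure0 //.
    by apply/seteqP; split => t // [].
  rewrite (_ : [set t | _] = good s); last first.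
    by apply/seteqP; split => t /= => [[]//|].
  have [ss|ss] := eqVneq (size s) N.+1; last first.
    rewrite (_ : good s = set0) ?measure0 //; apply/seteqP; split => t //= ts.
    by move: ss; rewrite -ts size_mkseq eqxx.
  apply: (etrans (trajectory_law ss)); apply: integral0_eq => t _; congr EFin.
  case: s ss sN => // x s [ss] sN; rewrite -ss in sN *.
  have := @quenched_probE _ beta (om t) (x :: s) isT; rewrite /= => ->.
  case: eqP => [x0|_]; last by rewrite mul0r.
  by rewrite x0 in sN *; rewrite mul1r; apply: path_prob_eq0.
have mpp s x : measurable_fun setT (fun t => path_prob beta (om t) x s).
  elim: s x => [|y s IH] x /=; first exact: measurable_cst.
  apply: measurable_funM => //.
  exact: (measurableT_comp (measurable_transition beta x y) mom).
have pp0 w s x : 0 <= path_prob beta w x s.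
  by elim: s x => //= y s IH x; rewrite mulr_ge0 // transition_ge0.
pose A (l : seq (seq vertex)) := [set t | exists s, (s \in l /\ E s) /\ trajectory N t = s] : set T.
have mA l : measurable (A l).
  apply: measurable_countable_union => s.
  have [h|h] := pselect (s \in l /\ E s).
    rewrite (_ : (fun _ => _) = good s); first exact: measurable_trajectory.
    by apply/seteqP; split => t /= => [[]//|].
  by rewrite (_ : (fun _ => _) = set0) //; apply/seteqP; split => t // [].
have mE : measurable [set t | E (trajectory N t)].
  rewrite (_ : [set t | _] = [set t | exists s, E s /\ trajectory N t = s]).
    apply: measurable_countable_union => s; case: (E s).
      rewrite (_ : (fun _ => _) = good s); first exact: measurable_trajectory.
      by apply/seteqP; split => t /= => [[]//|].
    by rewrite (_ : (fun _ => _) = set0) //; apply/seteqP; split => t // [].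
  by apply/seteqP; split => t /=; [exists (trajectory N t)|move=> [s [? ->]]].
split => //.
have PA l : {subset l <= nn_paths N 0} ->
    (P (A l) <= \sum_(s <- l) \int[P]_t (path_prob beta (om t) 0%R (behead s) * (E s)%:R)%:E)%E.
  elim: l => [|s l IH] lN.
    rewrite big_nil (_ : A [::] = set0) ?measure0 //.
    by apply/seteqP; split => t // [s [[]]].
  rewrite big_cons.
  have sN : s \in nn_paths N 0 by apply: lN; exact: mem_head.
  have [hs ss] := nn_paths_head sN.
  have Al : A (s :: l) `<=` [set t | E s /\ trajectory N t = s] `|` A l.
    move=> t /= [s' [[+ Es'] ts]]; rewrite inE => /orP[/eqP <-|s'l]; first by left.
    by right; exists s'.
  have m1 : measurable [set t | E s /\ trajectory N t = s].
    case: (E s).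
      rewrite (_ : [set t | _] = good s); first exact: measurable_trajectory.
      by apply/seteqP; split => t /= => [[]//|].
    by rewrite (_ : [set t | _] = set0) //; apply/seteqP; split => t // [].
  apply: (@le_trans _ _ (P ([set t | E s /\ trajectory N t = s] `|` A l))).
    by apply: le_measure => //; rewrite inE //; exact: measurableU.
  apply: (le_trans (measureU2 P m1 (mA l))); apply: leeD; last first.
    by apply: IH => s' s'l; apply: lN; rewrite inE s'l orbT.
  case: (E s) m1 => m1; last first.
    rewrite (_ : [set t | _] = set0) ?measure0.
      by apply: integral_ge0 => t _; rewrite mulr0.
    by apply/seteqP; split => t // [].
  rewrite (_ : [set t | _] = good s); last by apply/seteqP; split => t /= => [[]//|].
  rewrite le_eqVlt; apply/orP; left; apply/eqP; apply: (etrans (trajectory_law ss)).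
  apply: eq_integral => t _; congr EFin; rewrite mulr1.
  have := @quenched_probE _ beta (om t) s; rewrite ss hs eqxx mul1r; apply.
  by rewrite -size_eq0 ss.
have -> : (\int[P]_t (path_mean beta (om t) N 0%R (fun s => (E s)%:R))%:E =
    \sum_(s <- nn_paths N 0%R) \int[P]_t (path_prob beta (om t) 0%R (behead s) * (E s)%:R)%:E)%E.
  rewrite -ge0_integral_sum //.
  - by apply: eq_integral => t _; rewrite sumEFin path_meanE.
  - by move=> s; apply/measurable_EFinP/measurable_funM.
  - by move=> s t _; rewrite lee_fin mulr_ge0 // ler0n.
apply: le_trans (PA _ (fun _ => id)).
rewrite -[leRHS]adde0 -bad0; apply: le_trans (measureU2 P (mA _) mbad).
apply: le_measure; rewrite ?inE //; first exact: measurableU.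
move=> t /= Et; have [h|h] := boolP (trajectory N t \in nn_paths N 0); [left|right].
  by exists (trajectory N t).
by exists (trajectory N t).
Qed.

End trajectories.

(** * Geometric bounds and almost sure statements *)

Lemma borel_cantelli_geometric d (T : measurableType d) (R : realType)
    (P : probability T R) (B : nat -> set T) (C r : R) :
  0 <= C -> 0 <= r < 1 -> (forall k, measurable (B k)) ->
  (forall k, (P (B k) <= (C * r ^+ k)%:E)%E) ->
  {ae P, forall t, exists K, forall k, (K <= k)%N -> ~ B k t}.
Proof.
move=> C0 /andP[r0 r1] mB hB.
have sum_lt : (\sum_(0 <= n <oo) P (B n) < +oo)%E.
  apply: (@le_lt_trans _ _ (C / (1 - r))%:E); last exact: ltry.
  apply: lime_le; first by apply: is_cvg_nneseries => n _ _; exact: measure_ge0.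
  near=> n; apply: (@le_trans _ _ (\sum_(0 <= k < n) (C * r ^+ k)%:E)%E).
    by apply: lee_sum => k _.
  rewrite sumEFin lee_fin -mulr_sumr ler_pdivlMr ?subr_gt0 // -mulrA ler_piMr //.
  suff -> : (\sum_(0 <= k < n) r ^+ k) * (1 - r) = 1 - r ^+ n.
    by rewrite lerBlDr lerDl exprn_ge0.
  elim: (n) => [|k IH]; first by rewrite big_geq // mul0r expr0 subrr.
  by rewrite big_nat_recr //= mulrDl IH exprS; ring.
have L0 : P (lim_sup_set B) = 0%E by exact: lim_sup_set_cvg0.
exists (lim_sup_set B); split => //.
  apply: bigcapT_measurable => n; apply: bigcup_measurable => k _; exact: mB.
move=> t /= h n _ /=; apply: contrapT => nB; apply: h.
exists n => k nk Bk; apply: nB; exists k => //.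
Unshelve. all: by end_near.
Qed.

Lemma bernoulli (R : realDomainType) (x : R) n : 0 <= x <= 1 ->
  1 - n%:R * x <= (1 - x) ^+ n.
Proof.
move=> /andP[x0 x1]; elim: n => [|n IH]; first by rewrite expr0 mul0r subr0.
rewrite exprS; apply: (@le_trans _ _ ((1 - x) * (1 - n%:R * x))).
  have : 0 <= n%:R * x * x by rewrite !mulr_ge0.
  by rewrite -natr1; lra.
by rewrite ler_wpM2l // subr_ge0.
Qed.

Lemma root_pow2 (R : realType) (x : R) i : 1 < x ->
  exists2 u : R, 1 < u & u ^+ (2 ^ i) = x.
Proof.
elim: i x => [|i IH] x x1; first by exists x; rewrite // expn0 expr1.
have [] := IH (Num.sqrt x); first by rewrite -sqrtr1 ltr_sqrt // (lt_trans ltr01).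
move=> u u1 ux; exists u => //.
by rewrite expnS mulnC exprM ux sqr_sqrtr // ltW // (lt_trans ltr01).
Qed.

Lemma linear_le_geometric (R : realType) (x : R) : 1 < x ->
  exists2 C : R, 0 < C & forall n : nat, n.+1%:R <= C * x ^+ n.
Proof.
move=> x1; exists (1 + (x - 1)^-1).
  by rewrite addr_gt0 // invr_gt0 subr_gt0.
have x0 : 0 < x - 1 by rewrite subr_gt0.
have i0 : 0 < (x - 1)^-1 by rewrite invr_gt0.
elim=> [|n IH].
  by rewrite expr0 mulr1 lerDl ltW.
rewrite -natr1; apply: (@le_trans _ _ ((1 + (x - 1)^-1) * x ^+ n + x ^+ n)).
  by apply: lerD => //; apply: exprn_ege1; exact: ltW.
have xn : 0 <= x ^+ n by apply: exprn_ge0; lra.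
have hc : (x - 1)^-1 * (x - 1) = 1 by rewrite mulVf // gt_eqF.
rewrite exprS; move: (x ^+ n) xn ((x - 1)^-1) hc => y y0 c hc.
have -> : (1 + c) * (x * y) = (1 + c) * y + ((x - 1) + c * (x - 1)) * y by ring.
by have := mulr_ge0 (ltW x0) y0; rewrite hc; lra.
Qed.

Lemma poly_le_geometric (R : realType) (x : R) (e : nat) : 1 < x ->
  exists2 C : R, 0 < C & forall n : nat, n.+1%:R ^+ e <= C * x ^+ n.
Proof.
move=> x1; have [u u1 ux] := root_pow2 e x1.
have [C C0 hC] := linear_le_geometric u1.
have u0 : 0 <= u by lra.
exists (C ^+ e); first exact: exprn_gt0.
move=> n; apply: (@le_trans _ _ ((C * u ^+ n) ^+ e)).
  by apply: lerXn2r; rewrite ?nnegrE ?mulr_ge0 ?exprn_ge0 // ltW.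
rewrite exprMn ler_wpM2l ?exprn_ge0 ?(ltW C0) // -ux -!exprM mulnC.
by apply: ler_weXn2l; [exact: ltW|rewrite leq_mul2r ltnW ?orbT // ltn_expl].
Qed.

Lemma geometric_unbounded (R : realType) (x K : R) : 1 < x ->
  exists n : nat, K < x ^+ n.
Proof.
move=> x1; have [C C0 hC] := linear_le_geometric x1.
have [n hn] : exists n : nat, C * K < n%:R.
  exists (Num.truncn `|C * K|).+1.
  by apply: le_lt_trans (ler_norm _) _; exact: truncnS_gt.
exists n; rewrite -(ltr_pM2l C0); apply: (lt_le_trans hn); apply: le_trans (hC n).
by rewrite ler_nat.
Qed.

(** * Almost sure bounds on the displacement *)

Section tails.
Context {R : realType}.
Variables (p beta : R) (d : measure_display) (T : measurableType d).
Variables (P : probability T R) (om : T -> config) (Z : nat -> T -> vertex).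
Hypotheses (beta1 : 1 < beta) (walk : annealed_walk p beta P om Z).

Let mom : measurable_fun setT om. Proof. exact: annealed_measurable_env walk. Qed.

Let measurable_path_mean N E :
  measurable_fun [set: config] (fun w => path_mean beta w N 0 E).
Proof.
move: (0 : vertex) => x; elim: N x E => [|N IH] x E /=; first exact: measurable_cst.
apply: measurable_sum => y; apply: measurable_funM => //.
exact: measurable_transition.
Qed.

Let measurable_comp (f : config -> R) : measurable_fun [set: config] f ->
  measurable_fun setT (fun t => (f (om t))%:E).
Proof. by move=> mf; apply/measurable_EFinP; apply: measurableT_comp. Qed.

Lemma backward_bound (N b : nat) : (0 < b)%N ->
  measurable [set t | (last 0 (trajectory Z N t)).1 <= - b%:Z] /\
  (P [set t | ((last 0%R (trajectory Z N t)).1 <= - b%:Z)%R] <=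
    (4 * beta * (N.*2.+1 * N.*2.+1)%:R * beta ^- b)%R%:E)%E.
Proof.
move=> b0.
have [m h] := trajectory_event beta1 walk N (fun s => (last 0 s).1 <= - b%:Z).
split => //; apply: (le_trans h).
rewrite -[leRHS]mule1 -(@probability_setT _ _ _ P) -integral_cst //.
apply: ge0_le_integral => //.
- by move=> t _; rewrite lee_fin; apply: path_mean_ge0 => // s; rewrite ler0n.
- exact: (measurable_comp (measurable_path_mean N _)).
move=> t _; rewrite lee_fin.
rewrite (path_mean_last beta (om t) N (fun x => (x.1 <= - b%:Z)%R%:R) 0 0).
exact: step_iter_backward.
Qed.

Lemma lower_tail (j : nat) : (0 < j)%N ->
  {ae P, forall t, exists K, forall n, (K <= n)%N -> - n%:Z <= (Z n t).1 * j%:Z}.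
Proof.
(* The roots u of beta and v of u turn the bound of backward_bound, which
   is polynomial in n times beta^-(b n), into v^-n. *)
move=> j0; pose b n := (n %/ j).+1; have b1 := beta1.
have beta0 : 0 < beta by lra.
have [u u1 uE] := root_pow2 j beta1.
have u0 : 0 < u by lra.
have [v v1 vE] := root_pow2 1 u1.
have v0 : 0 < v by lra.
have [C C0 hC] := poly_le_geometric 2 v1.
pose B n := [set t | (last 0 (trajectory Z n t)).1 <= - (b n)%:Z].
have mB n : measurable (B n) by exact: (backward_bound n (ltn0Sn _)).1.
have hB n : (P (B n) <= ((16 * beta * C) * v^-1 ^+ n)%:E)%E.
  apply: (le_trans (backward_bound n (ltn0Sn _)).2); rewrite lee_fin.
  have h1 : (n.*2.+1 * n.*2.+1)%:R <= 4 * (C * v ^+ n).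
    apply: (@le_trans _ _ (4 * n.+1%:R ^+ 2)); last by rewrite ler_pM2l.
    by rewrite -natrX -natrM ler_nat; lia.
  have h2 : beta ^- b n <= u ^- n.
    rewrite lef_pV2 ?posrE ?exprn_gt0 //.
    rewrite -uE -exprM ler_weXn2l //; first lra.
    rewrite (leq_trans (ltnW (ltn_ceil n j0))) // mulnC leq_mul2r ltnW ?orbT //.
    exact: ltn_expl.
  have h3 : v ^+ n * u ^- n = v^-1 ^+ n.
    have -> : u = v * v by rewrite -vE -expr2.
    have vn0 : v ^+ n != 0 by rewrite expf_neq0 // gt_eqF.
    by rewrite exprMn exprVn; move: (v ^+ n) vn0 => y y0; field.
  rewrite -h3; have bn0 : 0 <= beta ^- b n by rewrite invr_ge0 exprn_ge0 // ltW.
  apply: (@le_trans _ _ (4 * beta * (4 * (C * v ^+ n)) * beta ^- b n)).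
    by apply: ler_wpM2r => //; apply: ler_wpM2l => //; lra.
  apply: (@le_trans _ _ (4 * beta * (4 * (C * v ^+ n)) * u ^- n)).
    apply: ler_wpM2l => //; rewrite !mulr_ge0 ?exprn_ge0 //; lra.
  by rewrite le_eqVlt; apply/orP; left; apply/eqP; ring.
have : {ae P, forall t, exists K, forall k, (K <= k)%N -> ~ B k t}.
  apply: (borel_cantelli_geometric _ _ mB hB).
    by rewrite !mulr_ge0 //; lra.
  by rewrite invr_ge0 ltW //= invf_lt1.
apply: filterS => t [K hK]; exists K => n /hK nB.
have lastE : last 0 (trajectory Z n t) = Z n t by rewrite /trajectory mkseqS last_rcons.
have h : - (b n)%:Z < (Z n t).1.
  by rewrite ltNge; apply/negP => h; apply: nB; rewrite /B /mkset lastE.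
have := leq_trunc_div n j; move: h; rewrite /b; move: (n %/ j)%N ((Z n t).1) => k z; nia.
Qed.

Variables (s : seq edge) (F : (edge -> bool) -> bool) (Ln B m : nat).
Hypotheses (us : uniq s) (dF : determined (fun e => (e \in s) && fresh e) F).
Hypotheses (p01 : 0 <= p <= 1) (Ln0 : (0 < Ln)%N).
Hypothesis trapF : forall w, F w -> exists D, trap w D m%:Z Ln%:Z B.
Let q : R := avg p s (fun w => (F w)%:R) (fun=> false).

Lemma hitting_bound (theta eta : R) k N : 0 < theta <= 1 -> 0 <= eta <= 1 ->
  (forall w, F w -> forall (a : int) N, Ln%:Z <= a ->
     hit beta w theta a (fun=> 1) N (0, 0) <= 1 - eta) ->
  measurable [set t | has (fun y => (Ln * k)%N%:Z <= y.1) (trajectory Z N t)] /\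
  (P [set t | has (fun y => ((Ln * k)%N%:Z <= y.1)%R) (trajectory Z N t)] <=
    (theta^-1 ^+ N * (1 - eta * q) ^+ k)%R%:E)%E.
Proof.
move=> /andP[t0 t1] /andP[e0 e1] slow.
have t01 : 0 <= theta <= 1 by rewrite t1 ltW.
have [mE h] := trajectory_event beta1 walk N (has (fun y : vertex => (Ln * k)%N%:Z <= y.1)).
split => //; apply: (le_trans h).
have Lk : Ln%:Z *+ k = (Ln * k)%N%:Z by rewrite PoszM -mulr_natr natz.
have Lz : 0 <= Ln%:Z by [].
have hb := renewal_bound beta1 walk us dF t01 Lz e0 slow p01 e1 k N.
rewrite Lk in hb.
have ti : 0 <= theta^-1 ^+ N by rewrite exprn_ge0 // invr_ge0 ltW.
apply: (@le_trans _ _ ((theta^-1 ^+ N)%:E *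
   \int[P]_t (hit beta (om t) theta (Ln * k)%N%:Z (fun=> 1%R) N 0%R)%:E)%E); last first.
  by rewrite EFinM lee_pmul2l // ?lte_fin ?exprn_gt0 ?invr_gt0.
have mh : measurable_fun setT (fun t => (hit beta (om t) theta (Ln * k)%N%:Z (fun=> 1) N 0)%:E).
  apply: (measurable_comp (f := fun w => hit beta w theta _ (fun=> 1) N 0)).
  exact: measurable_hit.
have h0 w : 0 <= hit beta w theta (Ln * k)%N%:Z (fun=> 1) N 0 by apply: hit_ge0 => //; exact: ltW.
rewrite -ge0_integralZl_EFin //; last by move=> t _; rewrite lee_fin.
apply: ge0_le_integral => //.
- by move=> t _; rewrite lee_fin; apply: path_mean_ge0 => // s'; rewrite ler0n.
- exact: (measurable_comp (measurable_path_mean N _)).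
- by apply/measurable_EFinP/measurable_funM => //; exact/measurable_EFinP.
move=> t _; rewrite -EFinM lee_fin exprVn ler_pdivlMl ?exprn_gt0 //.
exact: path_mean_hit.
Qed.

(** Reaching column Ln * k before time (k + 1) J has probability at most a
    constant times r^k, with r = theta^-J (1 - eta q) by the exponential
    Markov inequality. The hypothesis says that the mean delay over Ln columns
    exceeds J = j Ln, which makes r smaller than 1 for theta close to 1. *)
Lemma upper_tail (j : nat) : (0 < j)%N ->
  (j * Ln)%:R < q * (beta ^+ m / (16 * beta)) ->
  {ae P, forall t, exists K, forall n, (K <= n)%N -> (Z n t).1 * j%:Z <= n%:Z}.
Proof.
move=> j0 hA; have b1 := beta1; set V := beta ^+ m / (16 * beta) in hA.
pose J := (j * Ln)%N; have J0 : (0 < J)%N by rewrite muln_gt0 j0.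
have V0 : 0 < V by rewrite divr_gt0 ?exprn_gt0 ?mulr_gt0 //; lra.
have [th0 /andP[th00 th01] slow0] := trap_slows B beta1.
have [theta [t0 t1 tth tV]] : exists theta : R,
    [/\ 0 < theta, theta < 1, th0 <= theta & (1 - theta) * V <= 1].
  pose a := Num.max th0 (Num.max (1 / 2) (1 - V^-1)).
  have V1 : 0 < V^-1 by rewrite invr_gt0.
  exists a; split.
  - by rewrite /a !lt_max; apply/orP; right; apply/orP; left; lra.
  - by rewrite /a !gt_max th01 /=; lra.
  - by rewrite /a le_max lexx.
  - have : 1 - V^-1 <= a by rewrite /a !le_max lexx !orbT.
    move=> h; rewrite -ler_pdivlMr // mul1r; lra.
pose eta := (1 - theta) * V.
have e01 : 0 <= eta <= 1 by rewrite /eta mulr_ge0 ?(ltW V0) //=; lra.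
have slow w : F w -> forall (a : int) N, Ln%:Z <= a ->
    hit beta w theta a (fun=> 1) N (0, 0) <= 1 - eta.
  move=> Fw a N La; have [D tD] := trapF Fw.
  by apply: (slow0 theta _ w D m%:Z Ln%:Z) => //; rewrite tth.
have q0 : 0 <= q by apply: avg_ge0 => // w; rewrite ler0n.
have q1 : q <= 1 by apply: avg_le1 => // w; rewrite lern1 leq_b1.
have [e0 e1] := andP e01.
have eq1 : eta * q <= 1 by rewrite mulr_ile1.
pose r := theta^-1 ^+ J * (1 - eta * q).
have r01 : 0 <= r < 1.
  apply/andP; split.
    by rewrite mulr_ge0 ?exprn_ge0 ?invr_ge0 ?(ltW t0) // subr_ge0.
  rewrite /r exprVn mulrC ltr_pdivrMr ?exprn_gt0 // mul1r.
  have t01 : 0 <= 1 - theta <= 1 by lra.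
  have := bernoulli J t01; rewrite subKr => bern.
  apply: (lt_le_trans _ bern); rewrite ltrD2l ltrN2 /eta -mulrA.
  by rewrite [X in X < _]mulrC ltr_pM2l ?subr_gt0 // mulrC.
pose Bk k := [set t | has (fun y => (Ln * k)%N%:Z <= y.1) (trajectory Z (k.+1 * J) t)].
have t01 : 0 < theta <= 1 by rewrite t0 ltW.
have mB k : measurable (Bk k) by exact: (hitting_bound k _ t01 e01 slow).1.
have hB k : (P (Bk k) <= (theta^-1 ^+ J * r ^+ k)%:E)%E.
  apply: (le_trans (hitting_bound k _ t01 e01 slow).2); rewrite lee_fin.
  by rewrite mulSn exprD /r exprMn -exprM mulrA (mulnC J).
have : {ae P, forall t, exists K, forall k, (K <= k)%N -> ~ Bk k t}.
  apply: (borel_cantelli_geometric _ r01 mB hB).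
  by rewrite exprn_ge0 // invr_ge0 ltW.
apply: filterS => t [K hK]; exists (K * J)%N => n nK.
have nK' : (K <= n %/ J)%N by rewrite leq_divRL.
have nin : Z n t \in trajectory Z ((n %/ J).+1 * J) t.
  apply/mapP; exists n => //; rewrite mem_iota add0n ltnS.
  by rewrite (leq_trans (ltnW (ltn_ceil n J0))).
have hn : (Z n t).1 < (Ln * (n %/ J))%N%:Z.
  rewrite ltNge; apply/negP => h; apply: (hK _ nK').
  by rewrite /Bk /mkset; apply/hasP; exists (Z n t).
have := leq_trunc_div n J; move: hn.
move: (n %/ J)%N ((Z n t).1) => k z; rewrite /J => hz hk.
have : (z * j%:Z <= (Ln * k)%N%:Z * j%:Z) by rewrite ler_wpM2r // ltW.
move/le_trans; apply; rewrite -PoszM lez_nat.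
by rewrite (_ : (Ln * k * j = k * (j * Ln))%N) //; ring.
Qed.

End tails.

(** * The threshold *)

Lemma trap_size_eq (a b M : nat) :
  ((a * M.+1).+1 * b * 2 = a.+1 * b * 2 + a * b * 2 * M)%N.
Proof. by rewrite mulnS; ring. Qed.

Lemma trap_probability_eq (R : fieldType) (k h t b : R) (A E S N M : nat) :
  k ^+ (A + E * M) * (h ^+ S * t ^+ (M + M.+1 + M.+1)) * (b ^+ (N * M) / 16) =
  k ^+ A * h ^+ S * t ^+ 2 / 16 * (b ^+ N * t ^+ 3 * k ^+ E) ^+ M.
Proof.
have -> : (M + M.+1 + M.+1 = 2 + 3 * M)%N by lia.
rewrite (exprD k) (exprM k E) (exprD t) (exprM t 3) (exprM b) !exprMn.
move: (k ^+ A) (k ^+ E ^+ M) (h ^+ S) (t ^+ 2) (t ^+ 3 ^+ M) (b ^+ N ^+ M) (16^-1).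
by move=> *; ring.
Qed.

Section threshold.
Context {R : realType}.

(** The factor that one block of length 2 (n + 1) costs in tube_crossing. *)
Definition tube_cost (n : nat) : R := (1 / (2 * n.+1%:R ^+ 2)) ^+ 2.

(** Number of edges in one block of a trap. *)
Definition tube_edges (n : nat) : nat := n.+1.*2 * n.+1.*2.*2.+1 * 2.

(** Growth rate, in the number of blocks of a trap, of the lower bound for the
    mean delay: beta^(2 n + 2) for the time spent in it, one tube_cost for
    each of the tube and the two walls, and the comparison of p with 1/2 on
    the edges of a block. *)
Definition trap_gain (n : nat) (p beta : R) : R :=
  beta ^+ n.+1.*2 * tube_cost n ^+ 3 * (2 * (1 - p)) ^+ tube_edges n.

Lemma tube_cost_gt0 n : 0 < tube_cost n.
Proof. by rewrite exprn_gt0 // divr_gt0 // mulr_gt0 // exprn_gt0. Qed.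

Lemma trap_gain_le n p b b' : p <= 1 -> 0 <= b -> b <= b' ->
  trap_gain n p b <= trap_gain n p b'.
Proof.
move=> p1 b0 bb; have c0 := tube_cost_gt0 n.
have c1 : 0 <= tube_cost n ^+ 3 * (2 * (1 - p)) ^+ tube_edges n.
  by rewrite mulr_ge0 ?exprn_ge0 ?(ltW c0) //; lra.
rewrite /trap_gain -[leLHS]mulrA -[leRHS]mulrA; apply: ler_wpM2r => //.
by apply: lerXn2r => //; rewrite nnegrE; lra.
Qed.

Lemma geometric_beats_linear (x c K : R) : 1 < x -> 0 < c ->
  exists M : nat, K * M.+1%:R < c * x ^+ M.
Proof.
move=> x1 c0; have [C C0 hC] := poly_le_geometric 2 x1.
have [M hM] : exists M : nat, K * C / c < M.+1%:R.
  exists (Num.truncn `|K * C / c|).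
  by apply: le_lt_trans (ler_norm _) _; exact: truncnS_gt.
exists M; have M0 : 0 < M.+1%:R :> R by rewrite ltr0n.
rewrite ltr_pdivrMr // in hM.
have h1 := ler_wpM2l (ltW c0) (hC M).
have h2 : K * C * M.+1%:R < M.+1%:R * c * M.+1%:R by rewrite ltr_pM2r.
rewrite -(ltr_pM2l C0); move: h1 h2; rewrite expr2.
by move: (M.+1%:R) (x ^+ M) => u v; lra.
Qed.

Lemma zero_speed_of_tails d (T : measurableType d) (P : probability T R)
    (Z : nat -> T -> vertex) :
  (forall j, (0 < j)%N -> {ae P, forall t, exists K, forall n, (K <= n)%N ->
      - n%:Z <= (Z n t).1 * j%:Z}) ->
  (forall j, (0 < j)%N -> {ae P, forall t, exists K, forall n, (K <= n)%N ->
      (Z n t).1 * j%:Z <= n%:Z}) ->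
  {ae P, forall t : T,
     (fun n : nat => ((Z n t).1)%:~R / n%:R : R) @ \oo --> (0 : R)}.
Proof.
move=> lo hi.
have lo' := ae_foralln (fun j => lo j.+1 (ltn0Sn j)).
have hi' := ae_foralln (fun j => hi j.+1 (ltn0Sn j)).
apply: filterS2 lo' hi' => t lt ht.
apply/cvgr0Pnorm_le => e e0.
pose j := Num.truncn e^-1.
have [K1 h1] := lt j; have [K2 h2] := ht j.
exists (maxn K1 K2).+1 => // n /=; rewrite gtn_max => /andP[n1 n2].
have {h1}h1 := h1 n (ltnW n1); have {h2}h2 := h2 n (ltnW n2).
have n0 : 0 < n%:R :> R by rewrite ltr0n; lia.
have j0 : 0 < j.+1%:R :> R by rewrite ltr0n.
rewrite normrM normfV (gtr0_norm n0) ler_pdivrMr //.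
have ej : e^-1 < j.+1%:R by exact: truncnS_gt.
have ej' : 1 <= e * j.+1%:R.
  by rewrite -ler_pdivrMl // mulr1 ltW.
have hz : `|(Z n t).1%:~R| * j.+1%:R <= n%:R :> R.
  have -> : `|(Z n t).1%:~R| * j.+1%:R = (`|(Z n t).1| * j.+1%:Z)%:~R :> R.
    by rewrite intrM intr_norm.
  rewrite -[n%:R]/(n%:Z%:~R) ler_int.
  by move: h1 h2; move: ((Z n t).1) => z; lia.
rewrite -(ler_pM2r j0); apply: (le_trans hz).
by rewrite mulrAC -[leLHS]mul1r ler_wpM2r // ltW.
Qed.

(** With M blocks the mean delay is at least of order trap_gain^M, while the
    length of the trap is linear in M. *)
Lemma zero_speed (n : nat) (p beta : R) : 1 / 2 < p -> p < 1 -> 1 < beta ->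
  1 < trap_gain n p beta ->
  forall (d : measure_display) (T : measurableType d)
    (P : probability T R) (om : T -> config) (Z : nat -> T -> vertex),
    annealed_walk p beta P om Z ->
    {ae P, forall t : T,
       (fun n : nat => ((Z n t).1)%:~R / n%:R : R) @ \oo --> (0 : R)}.
Proof.
move=> p0 p1 b1 gain d T P om Z walk.
apply: zero_speed_of_tails => j j0; first exact: (lower_tail b1 walk).
have [i ni tube] := tube_crossing (R := R) n.
pose N2 := n.+1.*2; pose H2 := N2.*2.+1.
have a0 := tube_cost_gt0 n.
pose k := 2 * (1 - p).
have k0 : 0 < k by rewrite /k; lra.
pose c := k ^+ (N2.+1 * H2 * 2) * (1/2) ^+ (2 * H2) * tube_cost n ^+ 2 / 16.
have c0 : 0 < c.
  by rewrite divr_gt0 // mulr_gt0 ?exprn_gt0 // mulr_gt0 ?exprn_gt0 //; lra.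
have [M hM] := geometric_beats_linear (j * N2.+1)%:R gain c0.
pose l := (N2 * M.+1)%N.
have us : uniq (trap_edges n M) by exact: uniq_rect.
have p01 : 0 <= p <= 1 by lra.
apply: (upper_tail b1 walk us (@determined_trap_event n i M ni) p01
  (Ln := l.+1) (B := (l * H2)%N) (m := (N2 * M).+1)) => //.
  move=> w /(tube_trap ni)[D]; rewrite -/N2 -/H2 => tD; exists D.
  by rewrite -[(N2 * M).+1]add1n PoszD -[l.+1]addn1 PoszD.
have avg_lb : k ^+ size (trap_edges n M) *
    ((1/2) ^+ (2 * H2) * tube_cost n ^+ (M + M.+1 + M.+1)) <=
    avg p (trap_edges n M) (fun w => (trap_event n i M w)%:R) (fun=> false).
  have pp : 1 / 2 <= p < 1 by rewrite (ltW p0).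
  have T0 w : 0 <= (trap_event n i M w)%:R :> R by rewrite ler0n.
  apply: (le_trans _ (avg_half_le (trap_edges n M) (fun=> false) pp T0)).
  apply: ler_wpM2l; first by rewrite exprn_ge0 // ltW.
  exact: (@avg_trap_event n i M ni R (tube_cost n) _ (ltW a0) tube).
have bE : beta ^+ (N2 * M).+1 / (16 * beta) = beta ^+ (N2 * M) / 16.
  rewrite exprS; move: (beta ^+ _) => y; field; lra.
rewrite bE; apply: (@lt_le_trans _ _ (c * trap_gain n p beta ^+ M)).
  apply: le_lt_trans hM; rewrite -natrM ler_nat -mulnA leq_mul2l.
  by rewrite /l mulSn addSn ltnS leq_addl orbT.
have bM : 0 <= beta ^+ (N2 * M) / 16 by rewrite divr_ge0 // exprn_ge0 //; lra.
apply: (le_trans _ (ler_wpM2r bM avg_lb)).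
rewrite le_eqVlt; apply/orP; left; apply/eqP.
have -> : size (trap_edges n M) = (N2.+1 * H2 * 2 + tube_edges n * M)%N.
  by rewrite size_rect trap_size_eq.
by rewrite trap_probability_eq.
Qed.

Definition thresholds (p : R) : set R :=
  [set b | 1 < b /\ exists n, 1 < trap_gain n p b].

Lemma thresholds_lb p : lbound (thresholds p) 1.
Proof. by move=> b [/ltW]. Qed.

Lemma thresholds_nonempty p : p < 1 -> thresholds p !=set0.
Proof.
move=> p1; pose c := tube_cost 0 ^+ 3 * (2 * (1 - p)) ^+ tube_edges 0.
have c0 : 0 < c.
  by rewrite mulr_gt0 ?exprn_gt0 ?tube_cost_gt0 //; lra.
exists (1 + c^-1); have ci : 0 < c^-1 by rewrite invr_gt0.
split; first by lra.
exists 0%N; rewrite /trap_gain -mulrA -/c.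
apply: (@lt_le_trans _ _ ((1 + c^-1) * c)).
  by rewrite mulrDl mulVf ?gt_eqF // mul1r; lra.
apply: ler_wpM2r; first exact: ltW.
by rewrite expr2 ler_peMl //; lra.
Qed.

(** The cost of a tube is polynomial in its width n, whereas x^(2 n + 2) is
    exponential. *)
Lemma exists_tube_gain (x : R) : 1 < x ->
  exists n, 2 < x ^+ n.+1.*2 * tube_cost n ^+ 3.
Proof.
move=> x1; have [C C0 hC] := poly_le_geometric 12 x1.
(* The inverse of the cost is 64 N^12 with N = n + 1, to be beaten by a
   factor 2. *)
have [n hn] := geometric_unbounded (128 * C) x1.
exists n; have N0 : 0 < n.+1%:R :> R by rewrite ltr0n.
have -> : tube_cost n ^+ 3 = (64 * n.+1%:R ^+ 12)^-1.
  by rewrite /tube_cost; move: (n.+1%:R) N0 => N N0; field; rewrite gt_eqF.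
rewrite ltr_pdivlMr ?mulr_gt0 ?exprn_gt0 //.
apply: (@lt_le_trans _ _ (x ^+ n * x ^+ n)).
  have h := hC n; have x0 : 0 < x ^+ n by rewrite exprn_gt0 //; lra.
  have : 128 * C * x ^+ n < x ^+ n * x ^+ n by rewrite ltr_pM2r.
  by lra.
by rewrite -exprD; apply: ler_weXn2l; [exact: ltW|lia].
Qed.

End threshold.

Theorem theorem4 (R : realType) :
  exists beta_u : R -> R,
    (forall p : R, 1 / 2 < p -> p < 1 ->
       1 < beta_u p /\
       forall (beta : R), beta_u p < beta ->
       forall (d : measure_display) (T : measurableType d)
         (P : probability T R) (om : T -> config) (Z : nat -> T -> vertex),
         annealed_walk p beta P om Z ->
         {ae P, forall t : T,
            (fun n : nat => ((Z n t).1)%:~R / n%:R : R) @ \oo --> (0 : R)})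
    /\ beta_u p @[p --> (1 / 2 : R)^'+] --> (1 : R).
Proof.
(* The added p - 1/2 makes the threshold larger than 1, and leaves room for
   an element of thresholds p below every larger beta. *)
exists (fun p => inf (thresholds p) + (p - 1 / 2)).
have inf1 (p : R) : p < 1 -> 1 <= inf (thresholds p).
  by move=> p1; apply: lb_le_inf (thresholds_nonempty p1) (@thresholds_lb _ p).
split=> [p p0 p1|].
  split; first by have := inf1 p p1; lra.
  move=> beta hb.
  have hinf : has_inf (thresholds p).
    by split; [exact: thresholds_nonempty|exists 1; exact: thresholds_lb].
  have d0 : 0 < beta - inf (thresholds p) by lra.
  have [b [b1 [n gb]] bb] := inf_adherent d0 hinf.
  have {}bb : b < beta by lra.
  apply: (zero_speed (n := n)) => //; first exact: lt_trans bb.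
  by apply: (lt_le_trans gb); apply: trap_gain_le; lra.
apply/cvgrPdist_le => e e0.
have x1 : 1 < 1 + e / 2 by lra.
have [n hn] := exists_tube_gain x1.
pose S : R := (tube_edges n)%:R.
have S0 : 0 < S by rewrite ltr0n.
(* Within r of 1/2 the comparison factor of trap_gain is at least 1/2,
   which the factor 2 in exists_tube_gain compensates. *)
pose r : R := Num.min (1 / 4) (Num.min (e / 2) (1 / (4 * S))).
have r0 : 0 < r.
  by rewrite !lt_min; apply/and3P; split; [lra|lra|rewrite divr_gt0 ?mulr_gt0].
near=> p.
have p0 : 1 / 2 < p by near: p; exact: nbhs_right_gt.
have pr : p < 1 / 2 + r.
  by near: p; apply: nbhs_right_lt; rewrite ltrDl.
have r1 : r <= 1 / 4 by rewrite ge_min lexx.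
have r2 : r <= e / 2 by rewrite !ge_min lexx orbT.
have r3 : r <= 1 / (4 * S) by rewrite !ge_min lexx !orbT.
have p1 : p < 1 by lra.
have half : 1 / 2 <= (2 * (1 - p)) ^+ tube_edges n.
  have h : 0 <= 2 * (p - 1 / 2) <= 1 by lra.
  have := bernoulli (tube_edges n) h; rewrite -/S.
  have -> : 1 - 2 * (p - 1 / 2) = 2 * (1 - p) by field.
  have : (p - 1 / 2) * (4 * S) <= 1.
    by rewrite -ler_pdivlMr ?mulr_gt0 //; lra.
  lra.
have xG : thresholds p (1 + e / 2).
  split => //; exists n; rewrite /trap_gain.
  move: hn half; move: (_ * tube_cost n ^+ 3) (_ ^+ tube_edges n) => u v hu hv.
  nra.
have infx : inf (thresholds p) <= 1 + e / 2.
  by apply: ge_inf => //; exists 1; exact: thresholds_lb.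
have := inf1 p p1; rewrite ler_norml; lra.
Unshelve. all: by end_near.
Qed.
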